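(* Let $\mathbb{M}$ be the Euclidean plane $\mathbb{E}^2$ or the hyperbolic plane $\mathbb{H}^2$, and let $n \geq 3$ be an odd integer. If $C \subset \mathbb{M}$ is a disk and $P$ is a simple $n$-gon contained in $C$, then there is an isosceles triangle inscribed in $C$, whose three sides have lengths $\alpha, \beta, \beta$ with $\alpha \geq \beta$, such that $\operatorname{perim} P \leq (n-2)\alpha + 2\beta$.
   Context: A disk in $\mathbb{M}$ is a closed metric ball (of arbitrary positive radius) for the distance of $\mathbb{M}$. A simple $n$-gon is a polygon with $n$ edges (geodesic segments of $\mathbb{M}$), with each vertex belonging to exactly two edges and every other point belonging to at most one edge. $\operatorname{perim} P$ denotes the perimeter of $P$, i.e. the sum of the lengths of its edges. A triangle is inscribed in $C$ if its three vertices lie on the boundary of $C$. *)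

(* Defs.v *)
From HB Require Import structures.
From mathcomp Require Import all_boot all_order all_algebra.
From mathcomp Require Import ring lra.
From mathcomp Require Import mathcomp_extra boolp classical_sets reals.
From mathcomp Require Import topology normedtype exp.

Set Implicit Arguments.
Unset Strict Implicit.
Unset Printing Implicit Defensive.

Import Order.TTheory GRing.Theory Num.Theory.

Local Open Scope classical_set_scope.
Local Open Scope ring_scope.

Section EuclideanPlane.
Context {R : realType}.

(* A record rather than an alias of R * R, whose canonical distance is the one
   of the sup norm. *)
Record euclidean_plane : Type := EuclideanPoint { ecoord : R * R }.

HB.instance Definition _ := [isNew for ecoord].
HB.instance Definition _ := [Choice of euclidean_plane by <:].

Definition euclidean_dist (p q : euclidean_plane) : R :=
  Num.sqrt (((ecoord p).1 - (ecoord q).1) ^+ 2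
            + ((ecoord p).2 - (ecoord q).2) ^+ 2).

Lemma euclidean_distxx p : euclidean_dist p p = 0.
Proof. by rewrite /euclidean_dist !subrr expr0n addr0 sqrtr0. Qed.

Lemma euclidean_dist_positivity p q : euclidean_dist p q = 0 -> p = q.
Proof.
move/eqP; rewrite sqrtr_eq0 => h; apply: val_inj => /=.
case: p q h => [[x y]] [[x' y']] /= h.
have hx := sqr_ge0 (x - x'); have hy := sqr_ge0 (y - y').
have /eqP : (x - x') ^+ 2 = 0 by lra.
have /eqP : (y - y') ^+ 2 = 0 by lra.
by rewrite !sqrf_eq0 !subr_eq0 => /eqP -> /eqP ->.
Qed.

Lemma euclidean_dist_sym p q : euclidean_dist p q = euclidean_dist q p.
Proof.
rewrite /euclidean_dist -(sqrrN ((ecoord p).1 - _)).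
by rewrite -(sqrrN ((ecoord p).2 - _)) !opprB.
Qed.

Lemma euclidean_dist_triangle q p r :
  euclidean_dist p r <= euclidean_dist p q + euclidean_dist q r.
Proof.
case: p q r => [[x y]] [[x' y']] [[x'' y'']]; rewrite /euclidean_dist /=.
set u := x - x'; set v := y - y'; set s := x' - x''; set t := y' - y''.
have -> : x - x'' = u + s by rewrite /u /s; ring.
have -> : y - y'' = v + t by rewrite /v /t; ring.
have hu : 0 <= u ^+ 2 + v ^+ 2 by rewrite addr_ge0 ?sqr_ge0.
have hs : 0 <= s ^+ 2 + t ^+ 2 by rewrite addr_ge0 ?sqr_ge0.
rewrite -[leRHS]ger0_norm ?addr_ge0 ?sqrtr_ge0// -sqrtr_sqr ler_wsqrtr//.
rewrite (sqrrD (Num.sqrt _)) !sqr_sqrtr// -sqrtrM//.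
have cs : u * s + v * t <=
    Num.sqrt ((u ^+ 2 + v ^+ 2) * (s ^+ 2 + t ^+ 2)).
  rewrite (le_trans (ler_norm _))// -sqrtr_sqr ler_wsqrtr// -subr_ge0.
  have -> : (u ^+ 2 + v ^+ 2) * (s ^+ 2 + t ^+ 2) - (u * s + v * t) ^+ 2
    = (u * t - v * s) ^+ 2 by ring.
  exact: sqr_ge0.
lra.
Qed.

HB.instance Definition _ := @isMetric.Build R euclidean_plane
  euclidean_dist euclidean_distxx euclidean_dist_positivity
  euclidean_dist_sym euclidean_dist_triangle.

End EuclideanPlane.
Arguments euclidean_plane R : clear implicits.

(* The inverse hyperbolic cosine on [1, +oo[. *)
Definition arcosh {R : realType} (x : R) : R := ln (x + Num.sqrt (x ^+ 2 - 1)).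

Section HyperbolicPlane.
Context {R : realType}.

(* Minus the Lorentzian inner product of signature (2, 1). *)
Definition lorentz (p q : R * R * R) : R :=
  p.2 * q.2 - p.1.1 * q.1.1 - p.1.2 * q.1.2.

(* The hyperbolic plane of curvature -1, as the upper sheet of the hyperboloid. *)
Record hyperbolic_plane : Type := HyperbolicPoint {
  hcoord : R * R * R ;
  _ : (0 < hcoord.2) && (lorentz hcoord hcoord == 1) }.

HB.instance Definition _ := [isSub for hcoord].
HB.instance Definition _ := [Choice of hyperbolic_plane by <:].

Definition hyperbolic_dist (p q : hyperbolic_plane) : R :=
  arcosh (lorentz (hcoord p) (hcoord q)).

Lemma lorentzC p q : lorentz p q = lorentz q p.
Proof. by rewrite /lorentz; ring. Qed.

Lemma lorentz_ge1 p q : 1 <= lorentz (hcoord p) (hcoord q).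
Proof.
case: p q => [[[x y] z] /= /andP[z0 /eqP hz]].
case=> [[[x' y'] z'] /= /andP[z'0 /eqP hz']].
rewrite /lorentz /= in hz hz' *.
suff : 1 + (x * x' + y * y') <= z * z' by lra.
have zz0 : 0 <= z * z' by rewrite mulr_ge0 ?ltW.
rewrite (le_trans (ler_norm _))// -(ger0_norm zz0) -ler_sqr ?nnegrE//.
rewrite !real_normK ?num_real// -subr_ge0.
have -> : (z * z') ^+ 2 - (1 + (x * x' + y * y')) ^+ 2 =
  (x - x') ^+ 2 + (y - y') ^+ 2 + (x * y' - y * x') ^+ 2.
  have zE : z ^+ 2 = 1 + x ^+ 2 + y ^+ 2 by lra.
  have zE' : z' ^+ 2 = 1 + x' ^+ 2 + y' ^+ 2 by lra.
  by rewrite exprMn zE zE'; ring.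
by rewrite !addr_ge0 ?sqr_ge0.
Qed.

Lemma arcosh_le0 (a : R) : 1 <= a -> arcosh a <= 0 -> a = 1.
Proof.
move=> a1; have s0 := sqrtr_ge0 (a ^+ 2 - 1).
by rewrite /arcosh -ln1 ler_ln ?posrE ?ltr01//; lra.
Qed.

Lemma hyperbolic_distxx p : hyperbolic_dist p p = 0.
Proof.
rewrite /hyperbolic_dist; case: p => c /= /andP[_ /eqP ->].
by rewrite /arcosh expr1n subrr sqrtr0 addr0 ln1.
Qed.

Lemma hyperbolic_dist_positivity p q : hyperbolic_dist p q = 0 -> p = q.
Proof.
move=> h; have /arcosh_le0 := lorentz_ge1 p q.
rewrite -/(hyperbolic_dist p q) h lexx => /(_ isT) {}h; apply: val_inj => /=.
case: p q h => [[[x y] z] /= /andP[z0 /eqP hz]].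
case=> [[[x' y'] z'] /= /andP[z'0 /eqP hz']].
rewrite /lorentz /= in hz hz' *; move=> h.
have e : (x - x') ^+ 2 + (y - y') ^+ 2 + (x * y' - y * x') ^+ 2 = 0.
  have zE : z ^+ 2 = 1 + x ^+ 2 + y ^+ 2 by lra.
  have zE' : z' ^+ 2 = 1 + x' ^+ 2 + y' ^+ 2 by lra.
  have -> : (x - x') ^+ 2 + (y - y') ^+ 2 + (x * y' - y * x') ^+ 2 =
    z ^+ 2 * z' ^+ 2 - (1 + (x * x' + y * y')) ^+ 2.
    by rewrite zE zE'; ring.
  have -> : 1 + (x * x' + y * y') = z * z' by lra.
  by rewrite exprMn subrr.
have hx := sqr_ge0 (x - x'); have hy := sqr_ge0 (y - y').
have ht := sqr_ge0 (x * y' - y * x').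
have /eqP : (x - x') ^+ 2 = 0 by lra.
have /eqP : (y - y') ^+ 2 = 0 by lra.
rewrite !sqrf_eq0 !subr_eq0 => /eqP ey /eqP ex; subst x' y'.
have /eqP : z ^+ 2 = z' ^+ 2 by lra.
rewrite eqrXn2 ?ltW//.
by move=> /eqP ->.
Qed.

Lemma hyperbolic_dist_sym p q : hyperbolic_dist p q = hyperbolic_dist q p.
Proof. by rewrite /hyperbolic_dist lorentzC. Qed.

Lemma hyperbolic_dist_triangle q p r :
  hyperbolic_dist p r <= hyperbolic_dist p q + hyperbolic_dist q r.
Proof.
rewrite /hyperbolic_dist.
have a1 := lorentz_ge1 p q; have b1 := lorentz_ge1 q r.
have c1 := lorentz_ge1 p r.
have gram : 0 <= 1 + 2 * lorentz (hcoord p) (hcoord q)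
      * lorentz (hcoord q) (hcoord r) * lorentz (hcoord p) (hcoord r)
    - lorentz (hcoord p) (hcoord q) ^+ 2
    - lorentz (hcoord q) (hcoord r) ^+ 2
    - lorentz (hcoord p) (hcoord r) ^+ 2.
  case: p q r {a1 b1 c1} => [p /= /andP[_ /eqP hp]] [q /= /andP[_ /eqP hq]].
  case=> [r /= /andP[_ /eqP hr]].
  have -> : 1 + 2 * lorentz p q * lorentz q r * lorentz p r
      - lorentz p q ^+ 2 - lorentz q r ^+ 2 - lorentz p r ^+ 2
    = lorentz p p * lorentz q q * lorentz r r
      + 2 * lorentz p q * lorentz q r * lorentz p r
      - lorentz p q ^+ 2 * lorentz r r - lorentz q r ^+ 2 * lorentz p p
      - lorentz p r ^+ 2 * lorentz q q by rewrite hp hq hr; ring.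
  have -> : lorentz p p * lorentz q q * lorentz r r
      + 2 * lorentz p q * lorentz q r * lorentz p r
      - lorentz p q ^+ 2 * lorentz r r - lorentz q r ^+ 2 * lorentz p p
      - lorentz p r ^+ 2 * lorentz q q =
      (p.1.1 * (q.1.2 * r.2 - q.2 * r.1.2) - p.1.2 * (q.1.1 * r.2 - q.2 * r.1.1)
       + p.2 * (q.1.1 * r.1.2 - q.1.2 * r.1.1)) ^+ 2.
    by rewrite /lorentz; ring.
  exact: sqr_ge0.
move: (lorentz (hcoord p) (hcoord q)) (lorentz (hcoord q) (hcoord r))
  (lorentz (hcoord p) (hcoord r)) a1 b1 c1 gram => a b c a1 b1 c1 gram.
have sq (x : R) : 1 <= x -> 0 <= x ^+ 2 - 1.
  by move=> x1; rewrite subr_ge0 exprn_ege1.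
have pos (x : R) : 1 <= x -> 0 < x + Num.sqrt (x ^+ 2 - 1).
  by move=> x1; have := sqrtr_ge0 (x ^+ 2 - 1); lra.
rewrite /arcosh -lnM ?posrE ?pos// ler_ln ?posrE ?mulr_gt0 ?pos//.
have sa0 := sqrtr_ge0 (a ^+ 2 - 1); have sb0 := sqrtr_ge0 (b ^+ 2 - 1).
have saE := sqr_sqrtr (sq _ a1); have sbE := sqr_sqrtr (sq _ b1).
move: (Num.sqrt (a ^+ 2 - 1)) (Num.sqrt (b ^+ 2 - 1)) sa0 sb0 saE sbE.
move=> s t s0 t0 sE tE.
have cC : c <= a * b + s * t.
  suff : c - a * b <= s * t by lra.
  rewrite (le_trans (ler_norm _))// -(ger0_norm (mulr_ge0 s0 t0)).
  rewrite -ler_sqr ?nnegrE// !real_normK ?num_real// exprMn sE tE.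
  rewrite -subr_ge0; apply: le_trans gram _.
  by rewrite le_eqVlt; apply/orP; left; apply/eqP; ring.
have -> : (a + s) * (b + t) = (a * b + s * t) + (a * t + s * b) by ring.
apply: lerD => //.
have p0 : 0 <= a * t + s * b.
  by rewrite addr_ge0 ?mulr_ge0// (le_trans ler01).
rewrite -(ger0_norm p0) -sqrtr_sqr ler_wsqrtr//.
have -> : (a * t + s * b) ^+ 2 = (a * b + s * t) ^+ 2 - 1.
  have -> : (a * t + s * b) ^+ 2
    = a ^+ 2 * t ^+ 2 + s ^+ 2 * b ^+ 2 + 2 * a * b * s * t by ring.
  have -> : (a * b + s * t) ^+ 2
    = a ^+ 2 * b ^+ 2 + s ^+ 2 * t ^+ 2 + 2 * a * b * s * t by ring.
  by rewrite sE tE; ring.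
rewrite lerD2r ler_sqr ?nnegrE ?(le_trans ler01 c1)//.
by rewrite (le_trans _ cC)// (le_trans ler01 c1).
Qed.

HB.instance Definition _ := @isMetric.Build R hyperbolic_plane
  hyperbolic_dist hyperbolic_distxx hyperbolic_dist_positivity
  hyperbolic_dist_sym hyperbolic_dist_triangle.

End HyperbolicPlane.
Arguments hyperbolic_plane R : clear implicits.

Section MetricGeometry.
Context {R : realType} {M : metricType R}.
Implicit Types (x y z : M) (C : set M).

Definition geodesic_path x y (gamma : R -> M) : Prop :=
  [/\ gamma 0 = x, gamma (mdist x y) = y &
      forall s t, 0 <= s <= mdist x y -> 0 <= t <= mdist x y ->
        mdist (gamma s) (gamma t) = `|s - t|].

(* Both planes are uniquely geodesic: the union over the geodesic paths from
   x to y is there the image of the only one. *)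
Definition geodesic_segment x y : set M :=
  [set z | exists gamma t,
    [/\ geodesic_path x y gamma, 0 <= t <= mdist x y & z = gamma t]].

Definition collinear x y z : Prop :=
  exists2 gamma : R -> M, (forall s t, mdist (gamma s) (gamma t) = `|s - t|) &
    [/\ range gamma x, range gamma y & range gamma z].

Definition is_disk C : Prop :=
  exists c (r : R), 0 < r /\ C = [set x | mdist c x <= r].

Definition boundary C : set M := closure C `\` interior C.

(* The closed polygon P_0 P_1 ... P_(n-1) is given by its cyclic sequence of
   vertices, ordS being the successor modulo n. *)
Section Polygons.
Context {n : nat}.
Implicit Types P : 'I_n -> M.

Definition edge P (i : 'I_n) : set M := geodesic_segment (P i) (P (ordS i)).

Definition num_edges_at P x : nat := #|[pred i : 'I_n | x \in edge P i]|.

(* For n >= 3 the first condition forces the vertices to be distinct, since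
   edges are counted by their indices. *)
Definition simple_polygon P : Prop :=
  (forall k, num_edges_at P (P k) = 2%N) /\
  (forall x, ~ range P x -> (num_edges_at P x <= 1)%N).

Definition perim P : R := \sum_(i < n) mdist (P i) (P (ordS i)).

Definition polygon_in P C : Prop := forall i, edge P i `<=` C.

End Polygons.

Definition inscribed_triangle x y z C : Prop :=
  ~ collinear x y z /\ [/\ boundary C x, boundary C y & boundary C z].

End MetricGeometry.

(* Main.v *)
Require Import Defs.
From mathcomp Require Import all_boot all_order all_algebra.
From mathcomp Require Import ring lra.
From mathcomp Require Import mathcomp_extra boolp classical_sets reals.
From mathcomp Require Import topology normedtype sequences exp.

(** Let pq be a longest edge of P, of length alpha, and let kap d be d^2 / 2 in
    the Euclidean plane and cosh d - 1 in the hyperbolic one. In coordinates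
    (x, y) centered at the center of the disk and with pq horizontal, the disk
    is a Euclidean disk of some radius r, and kap of a distance is at most half
    the square of the Euclidean distance, with equality on circles about the
    center. If kap alpha <= 3 r^2 / 2, no edge is longer than a side of the
    inscribed equilateral triangle, which proves the bound. Otherwise
    kap alpha = 2 r^2 s^2 with s^2 + c^2 = 1 and 0 <= c < 1/2, and the triangle
    is the one with base from r (- s, - c) to r (s, - c) and apex (0, r); its
    base has length alpha, and kap beta = r^2 (1 + c). As no edge is longer than
    alpha, it suffices to find two edges of total length at most 2 beta, and, as
    kap is convex, two edges with kap-sum at most 2 r^2 (1 + c).

    Since n is odd, the direction of the edges cannot alternate between left and
    right: there are consecutive vertices u, v, w with monotone abscissas
    (odd_cycle_monotone_triple), and the two edges uv, vw are the ones wanted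
    (monotone_path_scale_le). If v lies in the band |y| <= c r, or v lies on one
    side of the band and neither u nor w on the other, the bound is an
    elementary estimate in the Euclidean disk (flat_path_sqr_dist,
    capped_path_sqr_dist). In the remaining case one of the edges, say uv,
    crosses the band, which contains pq. As P is simple, uv misses pq and so
    passes beside it; there is little room for that, because pq is long, and
    kap of the length of uv turns out to be at most
    2 r^2 (c + c^2) = 2 kap beta - kap alpha (crossing_edge_short), while vw is
    no longer than alpha. That geodesics be straight is used only here: in the
    hyperbolic plane the argument is carried out in the projective (Klein)
    model (chart_klein_sqr_dist_ge, chart_chord_le), where it becomes a
    statement on chords of a Euclidean disk (missed_chord_far_from_center).

    Both planes are treated at once through the notion of central_chart. *)

Set Implicit Arguments.
Unset Strict Implicit.
Unset Printing Implicit Defensive.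

Import Order.TTheory GRing.Theory Num.Theory.
Local Open Scope classical_set_scope.
Local Open Scope ring_scope.

(** * Planar estimates in a Euclidean disk *)

Section PlanarEstimates.
Context {R : realType}.
Implicit Types a b c s l r x y : R.

Lemma dot_le a b x y l r : 0 <= l -> 0 <= r ->
  a ^+ 2 + b ^+ 2 <= l ^+ 2 -> x ^+ 2 + y ^+ 2 <= r ^+ 2 ->
  a * x + b * y <= l * r.
Proof.
move=> l0 r0 ab xy; rewrite (le_trans (ler_norm _))//.
rewrite -(ger0_norm (mulr_ge0 l0 r0)) -ler_sqr ?nnegrE// !real_normK ?num_real//.
have h : (a ^+ 2 + b ^+ 2) * (x ^+ 2 + y ^+ 2) <= l ^+ 2 * r ^+ 2.
  by apply: ler_pM => //; rewrite addr_ge0 ?sqr_ge0.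
have := sqr_ge0 (a * y - b * x).
rewrite exprMn; lra.
Qed.

(** The point v lies in the band |y| <= c r. Up to a reflection x_v >= 0. Then
    the cross term of |uv|^2 is at most 2 r^2, as for any two points of the
    disk, while monotonicity gives x_v x_w >= x_v^2 in |vw|^2, and the band
    bounds - y_v y_w and y_v^2 by c r^2. *)
Lemma flat_path_sqr_dist r c xu yu xv yv xw yw : 0 <= r -> 0 <= c ->
  xu ^+ 2 + yu ^+ 2 <= r ^+ 2 -> xv ^+ 2 + yv ^+ 2 <= r ^+ 2 ->
  xw ^+ 2 + yw ^+ 2 <= r ^+ 2 -> xu <= xv <= xw ->
  - (c * r) <= yv <= c * r -> c <= 1 ->
  (xu - xv) ^+ 2 + (yu - yv) ^+ 2 + ((xv - xw) ^+ 2 + (yv - yw) ^+ 2)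
    <= 4 * r ^+ 2 * (1 + c).
Proof.
wlog xv0 : xu yu xv yv xw yw / 0 <= xv.
  move=> H r0 c0 Nu Nv Nw /andP[uv vw] hy c1.
  have [xv0|xv0] := leP 0 xv; first by apply: H => //; rewrite uv.
  have := H (- xw) yw (- xv) yv (- xu) yu.
  rewrite !sqrrN !lerN2 vw uv => /(_ _ r0 c0 Nw Nv Nu isT hy c1).
  lra.
move=> r0 c0 Nu Nv Nw /andP[uv vw] /andP[y1 y2] c1.
have dx : xv ^+ 2 <= xv * xw by rewrite expr2 ler_wpM2l.
have s1 := sqr_ge0 (xu + xv); have s2 := sqr_ge0 (yu + yv).
have yw1 : - r <= yw <= r.
  by rewrite -ler_norml -ler_sqr ?nnegrE// real_normK ?num_real//; have := sqr_ge0 xw; lra.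
have yv2 : yv ^+ 2 <= c * r ^+ 2.
  have : yv ^+ 2 <= (c * r) ^+ 2.
    by rewrite -real_normK ?num_real// ler_sqr ?nnegrE ?mulr_ge0// ler_norml y1.
  rewrite exprMn => /le_trans; apply; rewrite ler_wpM2r ?sqr_ge0// expr2.
  by rewrite ler_piMr.
have yvw : - (yv * yw) <= c * r ^+ 2.
  have /andP[? ?] := yw1.
  rewrite (le_trans (ler_norm _))// normrN normrM.
  have -> : c * r ^+ 2 = (c * r) * r by ring.
  by apply: ler_pM => //; rewrite ler_norml ?y1 ?y2//.
lra.
Qed.

(** The point v lies above the band and u, w above the chord from L = r (- s, -
    c) to R = r (s, - c). Up to a reflection x_v >= 0. Then L is at least as
    far from v as u is, and R as w is, unless w lies to the upper right of v,
    where v.w >= |v|^2 makes the second step short. Finally |vL|^2 + |vR|^2 = 2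
    |v|^2 + 2 r^2 + 4 c r y_v is greatest at the apex (0, r). *)
Lemma capped_path_sqr_dist r s c xu yu xv yv xw yw : 0 <= r -> 0 <= s ->
  0 <= c -> s ^+ 2 + c ^+ 2 = 1 ->
  xu ^+ 2 + yu ^+ 2 <= r ^+ 2 -> xv ^+ 2 + yv ^+ 2 <= r ^+ 2 ->
  xw ^+ 2 + yw ^+ 2 <= r ^+ 2 -> xu <= xv <= xw -> c * r <= yv ->
  - (c * r) <= yu -> - (c * r) <= yw ->
  (xu - xv) ^+ 2 + (yu - yv) ^+ 2 + ((xv - xw) ^+ 2 + (yv - yw) ^+ 2)
    <= 4 * r ^+ 2 * (1 + c).
Proof.
wlog xv0 : xu yu xv yv xw yw / 0 <= xv.
  move=> H r0 s0 c0 sc Nu Nv Nw /andP[uv vw] hv hu hw.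
  have [xv0|xv0] := leP 0 xv; first by apply: H => //; rewrite uv.
  have := H (- xw) yw (- xv) yv (- xu) yu.
  rewrite !sqrrN !lerN2 vw uv => /(_ _ r0 s0 c0 sc Nw Nv Nu isT hv hw hu).
  lra.
move=> r0 s0 c0 sc Nu Nv Nw /andP[uv vw] hv hu hw.
have cr0 : 0 <= c * r by rewrite mulr_ge0.
have sr0 : 0 <= s * r by rewrite mulr_ge0.
have [yvw|yvw] := ltP yv yw.
  have h1 : xv * xv <= xv * xw by rewrite ler_wpM2l.
  have h2 : yv * yv <= yv * yw by rewrite ler_wpM2l; lra.
  have s1 := sqr_ge0 (xu + xv); have s2 := sqr_ge0 (yu + yv).
  have : 0 <= r ^+ 2 * c by rewrite mulr_ge0 ?sqr_ge0.
  lra.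
have xvs : xv <= s * r.
  have h : xv ^+ 2 <= (s * r) ^+ 2.
    have : (c * r) ^+ 2 <= yv ^+ 2 by rewrite ler_sqr ?nnegrE//; lra.
    rewrite !exprMn; have -> : s ^+ 2 = 1 - c ^+ 2 by lra.
    lra.
  by move: h; rewrite ler_sqr ?nnegrE.
have hu2 : (xu - xv) ^+ 2 + (yu - yv) ^+ 2 <=
    (xv + s * r) ^+ 2 + (yv + c * r) ^+ 2.
  have dy0 : 0 <= yu + c * r by lra.
  have hd : 0 <= s * (xu + s * r) + c * (yu + c * r).
    have := @dot_le (- s) (- c) xu yu 1 r ler01 r0.
    rewrite !sqrrN expr1n sc => /(_ (lexx _) Nu).
    have -> : s * (xu + s * r) + c * (yu + c * r) =
      (s ^+ 2 + c ^+ 2) * r - (- s * xu - c * yu) by ring.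
    rewrite sc; lra.
  suff : 0 <= (xu + s * r) * xv + (yu + c * r) * yv.
    have : (s * r) ^+ 2 + (c * r) ^+ 2 = r ^+ 2.
      by rewrite !exprMn -mulrDl sc mul1r.
    lra.
  have [s00|sn0] := eqVneq s 0.
    have xv00 : xv = 0 by apply/eqP; rewrite eq_le xv0 (le_trans xvs)// s00 mul0r.
    by rewrite xv00 mulr0 add0r mulr_ge0//; lra.
  have sp : 0 < s by rewrite lt_def sn0.
  rewrite -(pmulr_rge0 _ sp).
  have h1 : 0 <= xv * (s * (xu + s * r) + c * (yu + c * r)) by rewrite mulr_ge0.
  have h2 : 0 <= (yu + c * r) * (s * yv - c * xv).
    rewrite mulr_ge0// subr_ge0 (@le_trans _ _ (c * (s * r)))//.
      by rewrite ler_wpM2l.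
    by rewrite mulrCA ler_wpM2l.
  lra.
have hw2 : (xv - xw) ^+ 2 + (yv - yw) ^+ 2 <=
    (xv - s * r) ^+ 2 + (yv + c * r) ^+ 2.
  have [xws|xws] := leP xw (s * r).
    apply: lerD.
      by rewrite -sqrrN -(sqrrN (xv - _)) ler_sqr ?nnegrE; lra.
    by rewrite ler_sqr ?nnegrE; lra.
  suff : 0 <= (xw - s * r) * xv + (yw + c * r) * yv.
    have : (s * r) ^+ 2 + (c * r) ^+ 2 = r ^+ 2.
      by rewrite !exprMn -mulrDl sc mul1r.
    lra.
  by rewrite addr_ge0// mulr_ge0//; lra.
have : yv * c <= r * c.
  rewrite ler_wpM2r// (le_trans (ler_norm _))// -ler_sqr ?nnegrE//.
  rewrite real_normK ?num_real//; have := sqr_ge0 xv; lra.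
move/(ler_wpM2l r0).
have : (s * r) ^+ 2 + (c * r) ^+ 2 = r ^+ 2.
  by rewrite !exprMn -mulrDl sc mul1r.
lra.
Qed.
(** The segment uv crosses the whole band and passes the height h of p at a
    point g at distance at least 2 r s to the right of p. As p is in the disk,
    g lies to the right of the two lines s x -+ c y = r (s^2 - c^2), which pass
    through the corners (s r, c r) and (s r, - c r), while v lies to the left
    of the first one and u to the left of the second one; so uv is steep, its
    slope dx/dy being at most c / s in absolute value. The parallel to uv
    through p meets the disk, hence is at distance at most r from the center,
    and it is at distance at least 2 r s . s from uv. *)
Lemma transversal_far_from_center (r s c xp h xu yu xv yv l m : R) :
  0 <= r -> 0 <= s -> 0 <= c -> s ^+ 2 + c ^+ 2 = 1 -> c <= s ->
  xp ^+ 2 + h ^+ 2 <= r ^+ 2 ->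
  xu ^+ 2 + yu ^+ 2 <= r ^+ 2 -> xv ^+ 2 + yv ^+ 2 <= r ^+ 2 ->
  yu < - (c * r) -> c * r < yv -> 0 < l < 1 ->
  h = yu + l * (yv - yu) ->
  xp + 2 * r * s <= xu + l * (xv - xu) ->
  (r * (s ^+ 2 - c ^+ 2)) ^+ 2 <=
    (xu + m * (xv - xu)) ^+ 2 + (yu + m * (yv - yu)) ^+ 2.
Proof.
move=> r0 s0 c0 sc cs Np Nu Nv hu hv /andP[l0 l1] hE far.
have cr0 : 0 <= c * r by rewrite mulr_ge0.
have sr0 : 0 <= s * r by rewrite mulr_ge0.
have half y x : x ^+ 2 + y ^+ 2 <= r ^+ 2 -> c * r <= y -> x <= s * r /\ - x <= s * r.
  move=> N hy; apply/andP.
  rewrite [- x <= _]lerNl andbC -ler_norml -ler_sqr ?nnegrE// real_normK ?num_real//.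
  have : (c * r) ^+ 2 <= y ^+ 2 by rewrite ler_sqr ?nnegrE//; lra.
  rewrite !exprMn; have -> : s ^+ 2 = 1 - c ^+ 2 by lra.
  lra.
have [xv1 xv2] := half yv xv Nv (ltW hv).
have [xu1 xu2] : xu <= s * r /\ - xu <= s * r.
  by apply: (half (- yu)); [rewrite sqrrN | lra].
set a := xv - xu; set b := yv - yu; rewrite -/a -/b in far hE *.
(* the crossing point lies to the right of both lines s x -+ c y = r (s^2 - c^2) *)
have g1 : - r + 2 * r * s ^+ 2 <= s * (xu + l * a) - c * h.
  have := @dot_le (- s) c xp h 1 r ler01 r0.
  rewrite sqrrN expr1n sc => /(_ (lexx _) Np).
  have := ler_wpM2l s0 far; lra.
have g2 : - r + 2 * r * s ^+ 2 <= s * (xu + l * a) + c * h.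
  have := @dot_le (- s) (- c) xp h 1 r ler01 r0.
  rewrite !sqrrN expr1n sc => /(_ (lexx _) Np).
  have := ler_wpM2l s0 far; lra.
have rE : r * s ^+ 2 + r * c ^+ 2 = r by rewrite -mulrDr sc mulr1.
have ab1 : s * a <= c * b.
  have h1 : s * xv <= s * (s * r) by rewrite ler_wpM2l.
  have h2 : c * (c * r) <= c * yv by rewrite ler_wpM2l// ltW.
  have : (1 - l) * (s * a) <= (1 - l) * (c * b).
    rewrite -subr_ge0; rewrite {}hE in g1; rewrite /a /b in g1 *; lra.
  by rewrite ler_pM2l// subr_gt0.
have ab2 : - (s * a) <= c * b.
  have h1 : s * xu <= s * (s * r) by rewrite ler_wpM2l.
  have h2 : c * (c * r) <= c * - yu by rewrite ler_wpM2l//; lra.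
  have : l * - (s * a) <= l * (c * b).
    rewrite -subr_ge0; rewrite {}hE in g2; rewrite /a /b in g2 *; lra.
  by rewrite ler_pM2l.
have b0 : 0 < b by rewrite /b; lra.
set n := Num.sqrt (a ^+ 2 + b ^+ 2).
have n0 : 0 <= n by exact: sqrtr_ge0.
have nE : n ^+ 2 = a ^+ 2 + b ^+ 2 by rewrite sqr_sqrtr// addr_ge0 ?sqr_ge0.
have sn : s * n <= b.
  rewrite -ler_sqr ?nnegrE ?mulr_ge0 ?(ltW b0)//.
  have : (s * a) ^+ 2 <= (c * b) ^+ 2.
    rewrite -real_normK ?num_real// ler_sqr ?nnegrE ?mulr_ge0 ?(ltW b0)//.
    by rewrite ler_norml ab1 andbT; lra.
  have bE : b ^+ 2 = s ^+ 2 * b ^+ 2 + c ^+ 2 * b ^+ 2.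
    by rewrite -mulrDl sc mul1r.
  rewrite !exprMn nE; lra.
set mx := xu + m * a; set my := yu + m * b.
have d0 : 0 <= r * (s ^+ 2 - c ^+ 2).
  by rewrite mulr_ge0// subr_ge0 ler_sqr ?nnegrE.
have key : r * (s ^+ 2 - c ^+ 2) * n <= b * mx + - a * my.
  have -> : b * mx + - a * my = b * (xu + l * a) - a * h.
    by rewrite /mx /my hE; ring.
  have h1 : b * (xp + 2 * r * s) <= b * (xu + l * a) by rewrite ler_wpM2l// ltW.
  have : - b * xp + a * h <= n * r.
    by apply: dot_le => //; rewrite sqrrN nE addrC.
  have h2 : 2 * (r * s) * (s * n) <= 2 * (r * s) * b.
    by rewrite ler_wpM2l// !mulr_ge0.
  have -> : r * (s ^+ 2 - c ^+ 2) * n = - (n * r) + 2 * (r * s) * (s * n).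
    have -> : c ^+ 2 = 1 - s ^+ 2 by lra.
    ring.
  lra.
have np : 0 < n by rewrite sqrtr_gt0 ltr_wpDl ?sqr_ge0// exprn_gt0//.
have mm0 : 0 <= mx ^+ 2 + my ^+ 2 by rewrite addr_ge0 ?sqr_ge0.
rewrite -(sqr_sqrtr mm0) ler_sqr ?nnegrE ?sqrtr_ge0//.
rewrite -(ler_pM2r np); apply: (le_trans key); rewrite [leRHS]mulrC; apply: dot_le => //; first exact: sqrtr_ge0.
  by rewrite sqrrN nE addrC.
by rewrite sqr_sqrtr.
Qed.

(** The two sides on which uv can pass by the segment pq are exchanged by the
    reflection in the vertical axis together with the exchange of p and q. *)
Lemma missed_chord_far_from_center (r s c xp xq h xu yu xv yv l m : R) :
  0 <= r -> 0 <= s -> 0 <= c -> s ^+ 2 + c ^+ 2 = 1 -> c <= s ->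
  xp ^+ 2 + h ^+ 2 <= r ^+ 2 -> xq ^+ 2 + h ^+ 2 <= r ^+ 2 ->
  (2 * r * s) ^+ 2 <= (xp - xq) ^+ 2 ->
  xu ^+ 2 + yu ^+ 2 <= r ^+ 2 -> xv ^+ 2 + yv ^+ 2 <= r ^+ 2 ->
  yu < - (c * r) -> c * r < yv -> 0 < l < 1 ->
  h = yu + l * (yv - yu) ->
  (forall k, 0 <= k <= 1 -> xu + l * (xv - xu) <> xp + k * (xq - xp)) ->
  (r * (s ^+ 2 - c ^+ 2)) ^+ 2 <=
    (xu + m * (xv - xu)) ^+ 2 + (yu + m * (yv - yu)) ^+ 2.
Proof.
wlog pq : xp xq / xp <= xq.
  move=> W r0 s0 c0 sc cs Np Nq D Nu Nv hu hv l01 hE miss.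
  have [pq|/ltW qp] := leP xp xq; first exact: (W xp xq).
  apply: (W xq xp) => //; first by rewrite -(sqrrN (xq - xp)) opprB.
  move=> k /andP[k0 k1] e; apply: (miss (1 - k)); first by lra.
  by rewrite e; ring.
move=> r0 s0 c0 sc cs Np Nq D Nu Nv hu hv l01 hE.
set g := xu + l * (xv - xu) => miss.
have {}D : 2 * r * s <= xq - xp.
  by rewrite -ler_sqr ?nnegrE ?mulr_ge0 ?subr_ge0// -(sqrrN (xq - _)) opprB.
have [qg|gq] := leP xq g.
  by apply: (@transversal_far_from_center r s c xp h _ _ _ _ l) => //; rewrite -/g; lra.
have [gp|pg] := leP g xp.
  have -> : xu + m * (xv - xu) = - (- xu + m * (- xv - - xu)) by ring.
  rewrite sqrrN.
  apply: (@transversal_far_from_center r s c (- xq) h _ _ _ _ l) => //;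
    rewrite ?sqrrN//; rewrite /g in gp; lra.
have d0 : 0 < xq - xp by lra.
exfalso; apply: (miss ((g - xp) / (xq - xp))); last by rewrite divfK ?gt_eqF//; ring.
by rewrite divr_ge0 ?ler_pdivrMr//; lra.
Qed.

End PlanarEstimates.

(** * Charts *)

(** The functions d ^ 2 / 2 and cosh d - 1 are the instances: increasing and
    convex functions of the distance that are polynomial in the coordinates. *)
Record distance_scale {R : realType} (kap : R -> R) : Prop := DistanceScale {
  scale0 : kap 0 = 0 ;
  scale_le : forall a b, 0 <= a -> 0 <= b -> (kap a <= kap b) = (a <= b) ;
  scale_mid : forall a b, 0 <= a -> 0 <= b ->
    2 * kap ((a + b) / 2) <= kap a + kap b ;
  scale_double : forall a, 0 <= a -> 4 * kap a <= kap (2 * a) }.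

(** A common model of both planes, seen from o. For eps = 0 it is the plane t =
    1 with Cartesian coordinates, for eps = 1 the hyperboloid t^2 = 1 + x^2 +
    y^2 with o at its vertex. In the coordinates (x, y) circles about o are
    Euclidean circles, and (x, y) does not shorten distances on the kap scale;
    in the coordinates (x, y) / t the geodesics are straight. The last clause
    gives a line through any two points u and v, and says that the cone over u
    and v in the space (x, y, t) is swept by the segment uv. *)
Record central_chart {R : realType} {M : metricType R} (kap : R -> R) (o : M)
    (eps : R) (x y t : M -> R) : Prop := CentralChart {
  chart_eps : eps = 0 \/ eps = 1 ;
  chart_t_gt0 : forall u, 0 < t u ;
  chart_sheet : forall u, t u ^+ 2 = 1 + eps * (x u ^+ 2 + y u ^+ 2) ;
  chart_center : x o = 0 /\ y o = 0 ;
  chart_dist : forall u v, 2 * kap (mdist u v) =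
    (x u - x v) ^+ 2 + (y u - y v) ^+ 2 - (t u - t v) ^+ 2 ;
  chart_surj : forall a b, exists u, x u = a /\ y u = b ;
  chart_line : forall u v, u <> v -> exists gamma : R -> M,
    [/\ forall s s', mdist (gamma s) (gamma s') = `|s - s'|,
        gamma 0 = u, gamma (mdist u v) = v &
        forall l m, 0 <= l -> 0 <= m -> 0 < l + m ->
          exists2 s, 0 <= s <= mdist u v & exists2 k, 0 < k &
            [/\ x (gamma s) = k * (l * x u + m * x v),
                y (gamma s) = k * (l * y u + m * y v) &
                t (gamma s) = k * (l * t u + m * t v)]] }.

Lemma geodesic_segment_refl {R : realType} {M : metricType R} (v : M) :
  geodesic_segment v v v.
Proof.
exists (fun=> v), 0; rewrite mdistxx lexx; split=> //; split=> // s s'.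
by rewrite mdistxx -!eq_le => /eqP <- /eqP <-; rewrite subrr normr0.
Qed.

Section Chart.
Context {R : realType} {M : metricType R} (kap : R -> R) (o : M) (eps : R).
Context (x y t : M -> R).
Hypothesis K : distance_scale kap.
Hypothesis H : central_chart kap o eps x y t.
Implicit Types (u v p q z : M) (r s c : R).

Definition sqnorm z := x z ^+ 2 + y z ^+ 2.
Let t0 := chart_t_gt0 H.
Let t_ge0 u : 0 <= t u. Proof. exact: ltW. Qed.

Lemma scale_inj a b : 0 <= a -> 0 <= b -> kap a = kap b -> a = b.
Proof.
by move=> a0 b0 ab; apply/eqP; rewrite eq_le -(scale_le K a0 b0) -(scale_le K b0 a0) ab lexx.
Qed.

Lemma chart_scale_le_sqr u v :
  2 * kap (mdist u v) <= (x u - x v) ^+ 2 + (y u - y v) ^+ 2.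
Proof. by rewrite (chart_dist H); have := sqr_ge0 (t u - t v); lra. Qed.

Lemma chart_t_inj u v : sqnorm u = sqnorm v -> t u = t v.
Proof.
move=> uv; apply/eqP; rewrite -(@eqrXn2 _ 2%N) ?ltW//.
by rewrite !(chart_sheet H) -/(sqnorm u) -/(sqnorm v) uv.
Qed.

Lemma chart_coord_inj u v : x u = x v -> y u = y v -> u = v.
Proof.
move=> xuv yuv; apply: mdist_positivity; apply: scale_inj; rewrite ?mdist_ge0//.
have := chart_dist H u v; rewrite xuv yuv (@chart_t_inj u v); last first.
  by rewrite /sqnorm xuv yuv.
by rewrite !subrr expr0n /= (scale0 K); lra.
Qed.

Lemma chart_dist_center u : 2 * kap (mdist o u) = sqnorm u - (t u - 1) ^+ 2.
Proof.
have [xo yo] := chart_center H.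
have to1 : t o = 1.
  apply/eqP; rewrite -(@eqrXn2 _ 2%N) ?ltW//.
  by rewrite (chart_sheet H) xo yo !expr0n addr0 mulr0 addr0 expr1n.
by rewrite (chart_dist H) xo yo to1 /sqnorm; ring.
Qed.

Lemma chart_t_ge1 u : 1 <= t u.
Proof.
rewrite -(@ler_sqr R) ?nnegrE ?t_ge0// expr1n (chart_sheet H) lerDl.
rewrite mulr_ge0 ?addr_ge0 ?sqr_ge0//.
by case: (chart_eps H) => ->.
Qed.

Lemma chart_t_le u v : sqnorm u <= sqnorm v -> t u <= t v.
Proof.
move=> uv; rewrite -(@ler_sqr R) ?nnegrE ?t_ge0// !(chart_sheet H) lerD2l.
by rewrite ler_wpM2l//; case: (chart_eps H) => ->.
Qed.

Lemma chart_dist_center_le u v : (mdist o u <= mdist o v) = (sqnorm u <= sqnorm v).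
Proof.
rewrite -(scale_le K) ?mdist_ge0//.
have := chart_dist_center u; have := chart_dist_center v.
have tu := chart_sheet H u; have tv := chart_sheet H v.
rewrite -/(sqnorm u) -/(sqnorm v) in tu tv.
case: (chart_eps H) => e; rewrite e ?mul0r ?mul1r in tu tv.
  have -> : t u = 1.
    by apply/eqP; rewrite -(@eqrXn2 _ 2%N) ?ltW// tu expr1n addr0.
  have -> : t v = 1.
    by apply/eqP; rewrite -(@eqrXn2 _ 2%N) ?ltW// tv expr1n addr0.
  by move=> hv hu; apply/idP/idP; lra.
move=> hv hu.
have -> : kap (mdist o u) = t u - 1 by lra.
have -> : kap (mdist o v) = t v - 1 by lra.
rewrite lerD2r -(@ler_sqr R) ?nnegrE ?t_ge0// tu tv; lra.
Qed.

Lemma geodesic_segment_ends u v : u <> v ->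
  geodesic_segment u v u /\ geodesic_segment u v v.
Proof.
move=> uv; have [gamma [iso g0 g1 _]] := chart_line H uv.
by split; exists gamma; [exists 0|exists (mdist u v)]; split=> //;
  rewrite ?lexx ?mdist_ge0.
Qed.

(** The two segments lie over the same ray of the space (x, y, t), which meets
    the sheet t^2 - eps (x^2 + y^2) = 1 only once. *)
Lemma chart_segments_meet u v p q (l m l' m' : R) : u <> v -> p <> q ->
  0 <= l -> 0 <= m -> 0 < l + m -> 0 <= l' -> 0 <= m' -> 0 < l' + m' ->
  l * x u + m * x v = l' * x p + m' * x q ->
  l * y u + m * y v = l' * y p + m' * y q ->
  l * t u + m * t v = l' * t p + m' * t q ->
  exists g, [/\ geodesic_segment u v g, geodesic_segment p q g &
    y g * (l * t u + m * t v) = t g * (l * y u + m * y v)].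
Proof.
move=> uv pq l0 m0 lm l'0 m'0 lm' ex ey et.
have [ga [iso g0 g1 /(_ l m l0 m0 lm)[s hs [k k0 []]]]] := chart_line H uv.
have [ga' [iso' g0' g1' /(_ l' m' l'0 m'0 lm')[s' hs' [k' k'0 []]]]] :=
  chart_line H pq.
rewrite -ex -ey -et => gx' gy' gt' gx gy gt.
have Ng := chart_sheet H (ga s); have Ng' := chart_sheet H (ga' s').
set X := l * x u + _ in gx gx'; set Y := l * y u + _ in gy gy'.
set T := l * t u + _ in gt gt'.
have kk : k = k'.
  apply/eqP; rewrite -(@eqrXn2 _ 2%N) ?ltW//; apply/eqP.
  have e1 : k ^+ 2 * (T ^+ 2 - eps * (X ^+ 2 + Y ^+ 2)) = 1.
    by move: Ng; rewrite gx gy gt; lra.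
  have e2 : k' ^+ 2 * (T ^+ 2 - eps * (X ^+ 2 + Y ^+ 2)) = 1.
    by move: Ng'; rewrite gx' gy' gt'; lra.
  have W0 : T ^+ 2 - eps * (X ^+ 2 + Y ^+ 2) != 0.
    by apply/eqP => W0; move: e1; rewrite W0 mulr0 => /esym/eqP; rewrite oner_eq0.
  by apply: (mulIf W0); rewrite e1 e2.
exists (ga s); split; [by exists ga, s| |by rewrite gy gt /Y /T; ring].
exists ga', s'; split=> //.
by apply: chart_coord_inj; rewrite ?gx ?gx' ?gy ?gy' kk.
Qed.

(** The line from o through z leaves the disk immediately after z. *)
Lemma chart_circle_boundary z :
  0 < mdist o z -> boundary [set u | mdist o u <= mdist o z] z.
Proof.
move=> r0; split; first by apply: subset_closure => /=.
move=> /nbhs_ballP[e /= e0]; rewrite ballEmdist => sub.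
have oz : o <> z by move=> oz; move: r0; rewrite oz mdistxx ltxx.
have [ga [iso g0 g1 _]] := chart_line H oz.
have := sub (ga (mdist o z + e / 2)); rewrite /= -{1}g1 iso.
have -> : mdist o z - (mdist o z + e / 2) = - (e / 2) by ring.
have e2 : 0 < e / 2 by rewrite divr_gt0.
rewrite normrN gtr0_norm// ltr_pdivrMr// ltr_pMr// ltr1n => /(_ isT).
rewrite -{1}g0 iso sub0r normrN ger0_norm; first by lra.
by rewrite addr_ge0 ?mdist_ge0// ltW.
Qed.

Lemma chart_circle_le z u : sqnorm z = sqnorm u -> mdist o z = mdist o u.
Proof. by move=> zu; apply/eqP; rewrite eq_le !chart_dist_center_le zu lexx. Qed.

(** The vector sum of u and v points to the midpoint of the segment uv, whose
    projective coordinates t z (x, y) / t are assumed to be at distance at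
    least d from the center; the bound is the scale of the length of the chord
    at distance d. *)
Lemma chart_chord_le z u v (d : R) : sqnorm u <= sqnorm z -> sqnorm v <= sqnorm z ->
  d ^+ 2 <= sqnorm z ->
  d ^+ 2 * (t u + t v) ^+ 2 <= t z ^+ 2 * ((x u + x v) ^+ 2 + (y u + y v) ^+ 2) ->
  kap (mdist u v) <= 2 * (sqnorm z - d ^+ 2).
Proof.
move=> uz vz dz h.
have := chart_dist H u v.
have tu := chart_sheet H u; have tv := chart_sheet H v; have tz := chart_sheet H z.
have tuz := chart_t_le uz; have tvz := chart_t_le vz.
rewrite -/(sqnorm u) in tu; rewrite -/(sqnorm v) in tv; rewrite -/(sqnorm z) in tz.
have T0 : 0 < t z ^+ 2 by rewrite exprn_gt0.
case: (chart_eps H) => e; rewrite e ?mul0r ?mul1r in tu tv tz.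
  have one w : t w ^+ 2 = 1 + 0 -> t w = 1.
    by rewrite addr0 => tw; apply/eqP; rewrite -(@eqrXn2 _ 2%N) ?ltW// tw expr1n.
  move: h; rewrite (one u tu) (one v tv) (one z tz) expr1n mul1r.
  rewrite /sqnorm in uz vz *; lra.
have S : (t u + t v) ^+ 2 * (t z ^+ 2 - d ^+ 2) <= (2 * t z) ^+ 2 * (t z ^+ 2 - d ^+ 2).
  apply: ler_wpM2r; first by lra.
  rewrite ler_sqr ?nnegrE ?mulr_ge0 ?addr_ge0 ?t_ge0//; lra.
move=> kE; rewrite -(ler_pM2l T0).
rewrite /sqnorm in uz vz tz tu tv *.
have : t z ^+ 2 * (4 + 2 * kap (mdist u v)) =
   t z ^+ 2 * ((t u + t v) ^+ 2 - ((x u + x v) ^+ 2 + (y u + y v) ^+ 2)).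
  congr (_ * _); lra.
have : (2 * t z) ^+ 2 * (t z ^+ 2 - d ^+ 2) = t z ^+ 2 * (4 * (1 + (x z ^+ 2 + y z ^+ 2) - d ^+ 2)).
  by rewrite exprMn tz; ring.
lra.
Qed.

(** On the circle through z the map t z (x, y) / t is the identity, and it
    shortens radial distances near that circle; a segment longer than the sides
    of the inscribed equilateral triangle is too long to be shortened. *)
Lemma chart_klein_sqr_dist_ge z p q : sqnorm p <= sqnorm z -> sqnorm q <= sqnorm z ->
  3 * sqnorm z <= 2 * kap (mdist p q) ->
  2 * kap (mdist p q) <=
    (t z * x p / t p - t z * x q / t q) ^+ 2 +
    (t z * y p / t p - t z * y q / t q) ^+ 2.
Proof.
wlog pq : p q / t q <= t p.
  move=> W pz qz h; have [pq|/ltW qp] := leP (t q) (t p); first exact: W.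
  have xE : mdist q p = mdist p q by rewrite metric_sym.
  have := W q p qp qz pz; rewrite xE => /(_ h).
  by rewrite -(sqrrN (t z * x q / t q - _)) -(sqrrN (t z * y q / t q - _)) !opprB.
move=> pz qz h.
have kE := chart_dist H p q.
have tp := chart_sheet H p; have tq := chart_sheet H q; have tz := chart_sheet H z.
have tpz := chart_t_le pz.
have p1 := chart_t_ge1 p; have q1 := chart_t_ge1 q.
rewrite -/(sqnorm p) in tp; rewrite -/(sqnorm q) in tq; rewrite -/(sqnorm z) in tz.
case: (chart_eps H) => e; rewrite e ?mul0r ?mul1r in tp tq tz.
  have one w : t w ^+ 2 = 1 + 0 -> t w = 1.
    by rewrite addr0 => tw; apply/eqP; rewrite -(@eqrXn2 _ 2%N) ?ltW// tw expr1n.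
  rewrite kE (one p tp) (one q tq) (one z tz) !divr1 !mul1r subrr expr0n subr0//.
have ab0 : 0 < (t p * t q) ^+ 2 by rewrite exprn_gt0 ?mulr_gt0.
rewrite -(ler_pM2r ab0).
set kp := 2 * kap _ in h kE *.
have pn : t p != 0 by rewrite gt_eqF. 
have qn : t q != 0 by rewrite gt_eqF. 
have -> : ((t z * x p / t p - t z * x q / t q) ^+ 2 +
    (t z * y p / t p - t z * y q / t q) ^+ 2) * (t p * t q) ^+ 2 =
  t z ^+ 2 * ((x p ^+ 2 + y p ^+ 2) * t q ^+ 2 + (x q ^+ 2 + y q ^+ 2) * t p ^+ 2
   - 2 * (x p * x q + y p * y q) * (t p * t q)).
  by field; rewrite pn qn.
have -> : x p ^+ 2 + y p ^+ 2 = t p ^+ 2 - 1 by rewrite -/(sqnorm p); lra.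
have -> : x q ^+ 2 + y q ^+ 2 = t q ^+ 2 - 1 by rewrite -/(sqnorm q); lra.
have -> : 2 * (x p * x q + y p * y q) = 2 * (t p * t q) - 2 - kp.
  by rewrite kE; rewrite /sqnorm in tp tq; lra.
have nz : sqnorm z = t z ^+ 2 - 1 by lra.
rewrite {}nz in h; move: {kE tp tq tz pn qn ab0 pz qz} kp h.
move: (t p) (t q) (t z) pq tpz p1 q1 => a b T ba aT a1 b1 kp h.
have c1 : T * (a - b) <= kp * (a * b).
  have : T * (a - b) <= a * (T - 1) by have := ler_wpM2l (le_trans ler01 (le_trans a1 aT)) b1; lra.
  move=> /le_trans; apply.
  have -> : kp * (a * b) = a * (kp * b) by ring.
  apply: ler_wpM2l; first by lra.
  apply: (@le_trans _ _ kp); last by rewrite ler_peMr//; have := exprn_ege1 2 (le_trans a1 aT); lra.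
  have := ler_wpM2l (le_trans ler01 (le_trans a1 aT)) (le_trans a1 aT); lra.
have c2 : T * (T - b) * (T * (a - b)) <= T * (T - b) * (kp * (a * b)).
  by apply: ler_wpM2l => //; rewrite mulr_ge0//; lra.
have c3 : T ^+ 2 * (a - b) * (a - b) <= T ^+ 2 * (a - b) * (T - b).
  by apply: ler_wpM2l; rewrite ?mulr_ge0 ?sqr_ge0//; lra.
have kp0 : 0 <= kp by have := exprn_ege1 2 (le_trans a1 aT); lra.
have c4 : T * (T - b) * (kp * (a * b)) <= (T ^+ 2 - a * b) * (kp * (a * b)).
  apply: ler_wpM2r; first by rewrite !mulr_ge0//; lra.
  have : b * a <= b * T by apply: ler_wpM2l; lra.
  lra.
lra.
Qed.
End Chart.

(** * Odd cycles and simple polygons *)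

Section CyclicSuccessor.
Context {n : nat}.
Implicit Types j k : 'I_n.

Lemma val_iter_ordS m j : val (iter m (@ordS n) j) = ((j + m) %% n)%N.
Proof.
elim: m => [|m IHm] /=; first by rewrite addn0 modn_small.
by rewrite IHm -addn1 modnDml addn1 addnS.
Qed.

Lemma iter_ordS_neq m j : (0 < m < n)%N -> iter m (@ordS n) j != j.
Proof.
move=> /andP[m0 mn]; apply/eqP => /(congr1 val); rewrite val_iter_ordS => e.
have : (j + m = j + 0 %[mod n])%N by rewrite addn0 e modn_small.
by move/eqP; rewrite eqn_modDl mod0n modn_small// eqn0Ngt m0.
Qed.

(** Otherwise ascents and descents of f alternate around a cycle of odd length.
    *)
Lemma odd_cycle_monotone_triple {R : realType} (f : 'I_n -> R) :
  odd n -> exists j, f j <= f (ordS j) <= f (ordS (ordS j)) \/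
                     f (ordS (ordS j)) <= f (ordS j) <= f j.
Proof.
move=> on; apply: contrapT => no.
have n0 : (0 < n)%N by case: (n) on.
pose b j := f j <= f (ordS j).
have bS j : b (ordS j) = ~~ b j.
  rewrite /b; have [h1|/ltW h1] := leP (f j) (f (ordS j)); last first.
    have [//|/ltW h2] := leP (f (ordS j)) (f (ordS (ordS j))).
    by exfalso; apply: no; exists j; right; rewrite h1 h2.
  by apply/negbTE/negP => h2; apply: no; exists j; left; rewrite h1 h2.
have bI m j : b (iter m (@ordS n) j) = odd m (+) b j.
  by elim: m => //= m IHm; rewrite bS IHm addNb.
pose j0 := Ordinal n0.
have : iter n (@ordS n) j0 = j0.
  by apply: val_inj; rewrite val_iter_ordS modnDr modn_small.
by move/(congr1 b); rewrite bI on; case: (b j0).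
Qed.

End CyclicSuccessor.

Section SimplePolygon.
Context {R : realType} {M : metricType R} {n : nat} (P : 'I_n -> M).
Hypothesis n3 : (3 <= n)%N.
Hypothesis simpleP : simple_polygon P.
Hypothesis ends : forall u v : M,
  geodesic_segment u v u /\ geodesic_segment u v v.

(** Each vertex lies on the two edges that end there, so on no third edge. *)
Lemma vertex_on_edge j k : edge P j (P k) -> k = j \/ k = ordS j.
Proof.
move=> jk; have [/(_ k) two _] := simpleP.
have [->|kj] := eqVneq k j; first by left.
right; apply/eqP; apply: contraT => kSj.
pose k' := ord_pred k.
have kE : ordS k' = k by rewrite /k' ord_predK.
have k'k : k' != k.
  have /= := @iter_ordS_neq n 1 k'; rewrite kE eq_sym; apply.
  by rewrite (leq_trans _ n3).
have k'j : k' != j by apply: contraNneq kSj => <-; rewrite kE.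
suff : (3 <= num_edges_at P (P k))%N by rewrite two.
have /card_uniqP /= <- : uniq [:: k; k'; j].
  by rewrite /= !inE negb_or kj k'j eq_sym k'k.
apply/subset_leq_card/fintype.subsetP => i; rewrite !inE.
case/or3P => /eqP -> //.
  by have [] := ends (P k) (P (ordS k)).
by rewrite /edge kE; have [] := ends (P k') (P k).
Qed.

Lemma consecutive_vertices_neq j : P j <> P (ordS j).
Proof.
move=> e; have : edge P (ordS j) (P j).
  by rewrite e; have [] := ends (P (ordS j)) (P (ordS (ordS j))).
move=> /vertex_on_edge[] /esym/eqP; apply/negP.
  by apply: (@iter_ordS_neq n 1); rewrite /= (leq_trans _ n3).
exact: (@iter_ordS_neq n 2).
Qed.

(** A common point of two edges is a vertex, and then an end of both. *)
Lemma edges_meet_at_end i j g : i <> j -> edge P i g -> edge P j g ->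
  g = P j \/ g = P (ordS j).
Proof.
move=> ij ig jg.
have [[k _ kg]|ng] := pselect (range P g).
  by move: jg; rewrite -kg => /vertex_on_edge[->|->]; [left|right].
have [_ /(_ _ ng)] := simpleP; rewrite leqNgt => /negP[].
have /card_uniqP /= <- : uniq [:: i; j] by rewrite /= inE andbT; apply/eqP.
apply/subset_leq_card/fintype.subsetP => k; rewrite !inE.
by case/orP => /eqP ->.
Qed.

Lemma perim_le a b j : (forall i, mdist (P i) (P (ordS i)) <= a) ->
  mdist (P j) (P (ordS j)) + mdist (P (ordS j)) (P (ordS (ordS j))) <= 2 * b ->
  perim P <= (n%:R - 2) * a + 2 * b.
Proof.
move=> le_a le_b; rewrite /perim.
have ne : ordS j != j by apply: (@iter_ordS_neq n 1); rewrite /= (leq_trans _ n3).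
rewrite (bigD1 j)//= (bigD1 (ordS j))//= addrA addrC.
apply: lerD => //.
apply: (@le_trans _ _ (\sum_(i < n | (i != j) && (i != ordS j)) a)).
  by apply: ler_sum => i _.
have : \sum_(i < n) a = a + (a + \sum_(i < n | (i != j) && (i != ordS j)) a).
  by rewrite (bigD1 j)//= (bigD1 (ordS j))//=.
rewrite sumr_const card_ord -mulr_natl; lra.
Qed.

End SimplePolygon.

(** * Edges next to the longest edge *)

Lemma geodesic_segmentC {R : realType} {M : metricType R} (u v g : M) :
  geodesic_segment u v g -> geodesic_segment v u g.
Proof.
have vu : mdist v u = mdist u v by rewrite metric_sym.
move=> [ga [s [[g0 g1 iso] /andP[s0 s1] ->]]].
exists (fun s => ga (mdist u v - s)), (mdist u v - s).
split; [split| |by rewrite subKr]; rewrite ?vu ?subr0 ?subrr//.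
- move=> s' s'' /andP[? ?] /andP[? ?]; rewrite iso; [|lra|lra].
  by rewrite -normrN; congr `|_|; ring.
- lra.
Qed.

(** This holds of pq itself, hence of all edges of a simple polygon with edge pq. *)
Definition noncrossing {R : realType} {M : metricType R} (u v p q : M) : Prop :=
  [\/ u = p /\ v = q, u = q /\ v = p |
    forall g, geodesic_segment u v g -> geodesic_segment p q g ->
      g = u \/ g = v].

Lemma noncrossingC {R : realType} {M : metricType R} (u v p q : M) :
  noncrossing u v p q -> noncrossing v u p q.
Proof.
case=> [[-> ->]|[-> ->]|uv]; [exact: Or32|exact: Or31|apply: Or33].
by move=> g /geodesic_segmentC gs /(uv _ gs) [->|->]; [right|left].
Qed.

Section LongestEdge.
Context {R : realType} {M : metricType R} (kap : R -> R) (o : M) (eps : R).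
Context (x y t : M -> R).
Hypothesis K : distance_scale kap.
Hypothesis H : central_chart kap o eps x y t.
Variables (z p q : M) (r s c : R).
Local Notation N := (sqnorm x y).
Hypotheses (r0 : 0 < r) (Nz : N z = r ^+ 2).
Hypotheses (s0 : 0 <= s) (c0 : 0 <= c) (sc : s ^+ 2 + c ^+ 2 = 1) (c12 : c <= 1 / 2).
Hypotheses (Np : N p <= N z) (Nq : N q <= N z).
Hypothesis pq_level : y p * t q = y q * t p.
Hypothesis pq_long : kap (mdist p q) = 2 * r ^+ 2 * s ^+ 2.
Let t0 := chart_t_gt0 H.
Let tN0 u : t u != 0. Proof. by rewrite gt_eqF. Qed.
(* Projective coordinates, in which geodesics are straight and the disk has
   radius r. *)
Let X u := t z * x u / t u.
Let Y u := t z * y u / t u.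

Let N_Klein u : N u <= N z -> X u ^+ 2 + Y u ^+ 2 <= r ^+ 2.
Proof.
move=> uz; rewrite /X /Y.
have -> : (t z * x u / t u) ^+ 2 + (t z * y u / t u) ^+ 2 =
    t z ^+ 2 * N u / t u ^+ 2.
  by rewrite /sqnorm; field; rewrite tN0.
rewrite ler_pdivrMr ?exprn_gt0// !(chart_sheet H).
have zE := Nz; rewrite Nz in uz; rewrite /sqnorm in uz zE *; rewrite zE; lra.
Qed.

Let Klein_Y_le u b : N u <= N z -> 0 <= b -> (b < y u -> b < Y u) /\ (y u < - b -> Y u < - b).
Proof.
move=> uz b0; have tu := chart_t_le H uz.
rewrite /Y ltr_pdivlMr// ltr_pdivrMr//; split => h.
  have h1 : b * t u <= b * t z by rewrite ler_wpM2l.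
  have : b * t z < y u * t z by rewrite ltr_pM2r.
  lra.
have h1 : b * t u <= b * t z by rewrite ler_wpM2l.
have : y u * t z < - b * t z by rewrite ltr_pM2r.
lra.
Qed.

(** In the projective coordinates pq is horizontal of length at least 2 r s,
    and it lies in the band. The segment uv crosses the line pq outside pq, so
    it stays at distance at least r (s^2 - c^2) from the center and its scale
    is at most 8 r^2 s^2 c^2, where 4 c (1 - c) <= 1. The bound of the
    statement is exactly what the scale of two legs of the triangle leaves
    besides the scale of pq. *)
Lemma crossing_edge_short u v : N u <= N z -> N v <= N z ->
  y u < - (c * r) -> c * r < y v ->
  noncrossing u v p q ->
  kap (mdist u v) <= 2 * r ^+ 2 * (c + c ^+ 2).
Proof.
move=> Nu Nv yu yv disj.
move: (r0) (s0) (c0) (sc) (c12) => rP sP cP scE cH.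
have cr0 : 0 <= c * r by rewrite mulr_ge0// ltW.
have s34 : 3 / 4 <= s ^+ 2.
  have : c * c <= 1 / 2 * (1 / 2) by apply: ler_pM.
  lra.
have cs : c <= s.
  rewrite -ler_sqr ?nnegrE//; lra.
have hE : Y p = Y q.
  rewrite /Y; apply/eqP; rewrite eqr_div ?tN0// -!mulrA pq_level; apply/eqP; ring.
have pqX : (2 * r * s) ^+ 2 <= (X p - X q) ^+ 2.
  have := @chart_klein_sqr_dist_ge _ _ _ _ _ _ _ _ H z p q Np Nq.
  rewrite -/(X p) -/(X q) -/(Y p) -/(Y q) hE subrr expr0n addr0 Nz pq_long.
  have : r ^+ 2 * (3 / 4) <= r ^+ 2 * s ^+ 2 by rewrite ler_wpM2l// sqr_ge0.
  move=> h1 h2; apply: le_trans (h2 _); lra.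
have NXp := N_Klein Np; have NXq := N_Klein Nq; rewrite -hE in NXq.
set h := Y p in hE NXp NXq.
have hc : - (c * r) <= h <= c * r.
  rewrite -ler_norml -ler_sqr ?nnegrE// real_normK ?num_real//.
  have -> : (c * r) ^+ 2 = r ^+ 2 - (s * r) ^+ 2.
    by rewrite -[r ^+ 2]mul1r -sc; ring.
  have := sqr_ge0 (X p + X q); lra.
have NXu := N_Klein Nu; have NXv := N_Klein Nv.
have YU : Y u < - (c * r) by case: (Klein_Y_le Nu cr0) => _; apply.
have YV : c * r < Y v by case: (Klein_Y_le Nv cr0) => + _; apply.
have {}disj : forall g, geodesic_segment u v g -> geodesic_segment p q g ->
    g = u \/ g = v.
  case: disj => // -[uE _]; have [h1 _] := andP hc; move: YU; rewrite uE -?hE -/h; lra.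
have bp : 0 < Y v - Y u by lra.
set l := (h - Y u) / (Y v - Y u).
have l01 : 0 < l < 1.
  by rewrite /l divr_gt0//=; [rewrite ltr_pdivrMr//; lra|lra].
have hl : h = Y u + l * (Y v - Y u).
  by rewrite /l divfK ?gt_eqF//; ring.
set gx := X u + l * (X v - X u).
(* A common point of the two segments would be u or v, but its projective
   ordinate h does not exceed c r in absolute value. *)
have outside l' : 0 <= l' <= 1 -> gx <> X p + l' * (X q - X p).
  move=> /andP[l'0 l'1] gxE.
  have uv : u <> v by move=> uv; move: yu yv; rewrite uv; lra.
  have pq : p <> q.
    move=> pq; move: pqX; rewrite pq subrr expr0n /= leNgt exprn_gt0//.
    rewrite !mulr_gt0// lt_def s0 andbT; apply/eqP => s00.
    by move: s34; rewrite s00; lra.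
  have k0 (a : R) w : 0 <= a -> 0 <= a * (t z / t w).
    by move=> a0; rewrite mulr_ge0// divr_ge0 ?ltW.
  have k1 (a : R) w : 0 < a -> 0 < a * (t z / t w).
    by move=> a0; rewrite mulr_gt0// divr_gt0.
  have [la lb] := andP l01.
  have [] := @chart_segments_meet _ _ _ _ _ _ _ _ K H u v p q
    ((1 - l) * (t z / t u)) (l * (t z / t v))
    ((1 - l') * (t z / t p)) (l' * (t z / t q)) uv pq.
  - by apply: k0; lra.
  - by apply: k0; lra.
  - by apply: ltr_pDl; apply: k1; lra.
  - by apply: k0; lra.
  - by apply: k0; lra.
  - have [->|l'n] := eqVneq l' 0.
      by rewrite mul0r addr0; apply: k1; lra.
    apply: ltr_wpDl; first by apply: k0; lra.
    by apply: k1; rewrite lt_def l'n.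
  - transitivity gx; first by rewrite /gx /X; field; rewrite !tN0.
    by rewrite gxE /X; field; rewrite !tN0.
  - transitivity h; first by rewrite hl /Y; field; rewrite !tN0.
    transitivity ((1 - l') * h + l' * Y q); first by rewrite -hE; ring.
    by rewrite /h /Y; field; rewrite !tN0.
  - by transitivity (t z); field; rewrite !tN0.
  move=> g [guv gpq].
  have -> : (1 - l) * (t z / t u) * t u + l * (t z / t v) * t v = t z.
    by field; rewrite !tN0.
  have -> : (1 - l) * (t z / t u) * y u + l * (t z / t v) * y v = h.
    by rewrite hl /Y; field; rewrite !tN0.
  move=> gE; have [h1 h2] := andP hc.
  have gz : N g <= N z by case: (disj g guv gpq) => ->.
  have [gu gv] := Klein_Y_le gz cr0.
  have Yg : Y g = h by rewrite /Y [t z * _]mulrC gE mulrAC divff ?mul1r.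
  case: (disj g guv gpq) => gg; rewrite gg in gu gv Yg.
    by have := gv yu; lra.
  by have := gu yv; lra.
set m := t v / (t u + t v).
have tuv : t u + t v != 0 by rewrite gt_eqF// addr_gt0.
have far : (r * (s ^+ 2 - c ^+ 2)) ^+ 2 <=
    (X u + m * (X v - X u)) ^+ 2 + (Y u + m * (Y v - Y u)) ^+ 2.
  by apply: (@missed_chord_far_from_center _ r s c (X p) (X q) h _ _ _ _ l) => //;
    exact: ltW.
have d2 : (s ^+ 2 - c ^+ 2) ^+ 2 = 1 - 4 * c ^+ 2 + 4 * c ^+ 4.
  by have -> : s ^+ 2 = 1 - c ^+ 2; [lra | ring].
have c4 : c ^+ 4 <= c ^+ 2.
  have -> : c ^+ 4 = c ^+ 2 * c ^+ 2 by ring.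
  by rewrite ler_piMr ?sqr_ge0// expr_le1//; lra.
have := @chart_chord_le _ _ _ _ _ _ _ _ H z u v (r * (s ^+ 2 - c ^+ 2)) Nu Nv.
rewrite Nz exprMn d2 => cl.
have fin : r ^+ 2 * (0 : R) <= r ^+ 2 * (c * (1 + c) * (1 - 2 * c) ^+ 2).
  by rewrite ler_wpM2l ?sqr_ge0// !mulr_ge0 ?sqr_ge0//; lra.
apply: (le_trans (cl _ _)); last by lra.
  by rewrite ler_piMr ?sqr_ge0//; lra.
rewrite -d2 -exprMn.
have := ler_wpM2r (sqr_ge0 (t u + t v)) far.
move=> /le_trans; apply; rewrite le_eqVlt; apply/orP; left; apply/eqP.
by rewrite /X /Y /m; field; rewrite !tN0.
Qed.

(** The bound is the sum of the scales of the two legs of the isosceles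
    triangle with base as long as pq. If one of the two edges crosses the band,
    it is short and the other one is at most pq; if not, the planar estimates
    apply to the coordinates (x, y). *)
Lemma monotone_path_scale_le u v w : N u <= N z -> N v <= N z -> N w <= N z ->
  kap (mdist u v) <= kap (mdist p q) -> kap (mdist v w) <= kap (mdist p q) ->
  noncrossing u v p q ->
  noncrossing v w p q ->
  x u <= x v <= x w ->
  kap (mdist u v) + kap (mdist v w) <= 2 * r ^+ 2 * (1 + c).
Proof.
move=> Nu Nv Nw kuv kvw duv dvw uvw.
move: (r0) (s0) (c0) (sc) (c12) => rP sP cP scE cH.
have dvu := noncrossingC duv; have dwv := noncrossingC dvw.
have := chart_scale_le_sqr H u v; have := chart_scale_le_sqr H v w => pvw puv.
have vu : mdist v u = mdist u v by rewrite metric_sym.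
have wv : mdist w v = mdist v w by rewrite metric_sym.
have rge0 := ltW r0.
have [N1 N2 N3] : [/\ x u ^+ 2 + y u ^+ 2 <= r ^+ 2, x v ^+ 2 + y v ^+ 2 <= r ^+ 2
  & x w ^+ 2 + y w ^+ 2 <= r ^+ 2] by rewrite -Nz.
have split : 2 * r ^+ 2 * (c + c ^+ 2) + 2 * r ^+ 2 * s ^+ 2 = 2 * r ^+ 2 * (1 + c).
  by rewrite -sc; ring.
rewrite pq_long in kuv kvw.
have [hv1|hv1] := ltP (c * r) (y v).
  have [hu|hu] := ltP (y u) (- (c * r)).
    by have := crossing_edge_short Nu Nv hu hv1 duv; lra.
  have [hw|hw] := ltP (y w) (- (c * r)).
    by have := crossing_edge_short Nw Nv hw hv1 dwv; rewrite wv; lra.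
  have := @capped_path_sqr_dist _ r s c (x u) (y u) (x v) (y v) (x w) (y w) rge0
    s0 c0 sc N1 N2 N3 uvw (ltW hv1) hu hw.
  lra.
have [hv2|hv2] := ltP (y v) (- (c * r)).
  have [hu|hu] := ltP (c * r) (y u).
    by have := crossing_edge_short Nv Nu hv2 hu dvu; rewrite vu; lra.
  have [hw|hw] := ltP (c * r) (y w).
    by have := crossing_edge_short Nv Nw hv2 hw dvw; lra.
  have := @capped_path_sqr_dist _ r s c (x u) (- y u) (x v) (- y v) (x w) (- y w)
    rge0 s0 c0 sc.
  rewrite !sqrrN lerN2 => /(_ N1 N2 N3 uvw) h.
  have : c * r <= - y v by lra.
  by move=> /h; rewrite lerN2 => /(_ hu hw); lra.
have := @flat_path_sqr_dist _ r c (x u) (y u) (x v) (y v) (x w) (y w) rge0 c0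
  N1 N2 N3 uvw.
rewrite hv1 hv2 => /(_ isT); lra.
Qed.

End LongestEdge.

(** * The inscribed triangle and the perimeter *)

(** The point w is equidistant from u and v on their line, hence the midpoint.
    *)
Lemma isosceles_collinear {R : realType} {M : metricType R} (u v w : M) :
  mdist v w = mdist w u -> 0 < mdist u v -> collinear u v w ->
  mdist u v = 2 * mdist v w.
Proof.
move=> e uv0 [ga iso [[a _ au] [b _ bv] [c _ cw]]].
subst u v w; move: e uv0; rewrite !iso => e; rewrite normr_gt0 subr_eq0 => ab.
have /eqP := e; rewrite eqr_norm2 => /orP[] /eqP h.
  have -> : a - b = - (2 * (b - c)) by lra.
  by rewrite normrN normrM ger0_norm.
by move: ab; have -> : a = b; [lra | rewrite eqxx].
Qed.

Section InscribedTriangle.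
Context {R : realType} {M : metricType R} (kap : R -> R) (o : M) (eps : R).
Context (x y t : M -> R).
Hypothesis K : distance_scale kap.
Hypothesis H : central_chart kap o eps x y t.
Local Notation N := (sqnorm x y).

Lemma scale_gt0 a : 0 <= a -> 0 < kap a -> 0 < a.
Proof.
by move=> a0; rewrite [0 < a]lt_def a0 andbT; apply: contraTneq => ->; rewrite (scale0 K) ltxx.
Qed.

(** The triangle with vertices r (- s, - c), r (s, - c) and (0, r). It is not
    degenerate because the scale of twice a leg is at least 4 r^2 (1 + c), more
    than that of the base. *)
Lemma inscribed_isosceles_triangle (z : M) (r s c : R) :
  0 < r -> N z = r ^+ 2 -> 0 < mdist o z -> 0 <= s -> 0 <= c ->
  s ^+ 2 + c ^+ 2 = 1 -> c <= 1 / 2 ->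
  exists u v w : M,
    [/\ inscribed_triangle u v w [set a | mdist o a <= mdist o z],
        mdist v w = mdist w u, mdist v w <= mdist u v,
        kap (mdist u v) = 2 * r ^+ 2 * s ^+ 2 &
        kap (mdist v w) = r ^+ 2 * (1 + c)].
Proof.
move=> r0 Nz oz s0 c0 sc c12.
have r20 : 0 < r ^+ 2 by rewrite exprn_gt0.
have [u [xu yu]] := chart_surj H (- (s * r)) (- (c * r)).
have [v [xv yv]] := chart_surj H (s * r) (- (c * r)).
have [w [xw yw]] := chart_surj H 0 r.
have scr : (s * r) ^+ 2 + (c * r) ^+ 2 = r ^+ 2.
  by rewrite !exprMn -mulrDl sc mul1r.
have Nu : N z = N u by rewrite Nz /sqnorm xu yu !sqrrN scr.
have Nv : N z = N v by rewrite Nz /sqnorm xv yv sqrrN scr.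
have Nw : N z = N w by rewrite Nz /sqnorm xw yw expr0n add0r.
have tu := chart_t_inj H Nu; have tv := chart_t_inj H Nv.
have tw := chart_t_inj H Nw.
have kuv : kap (mdist u v) = 2 * r ^+ 2 * s ^+ 2.
  by have := chart_dist H u v; rewrite -tu -tv xu yu xv yv; lra.
have kvw : kap (mdist v w) = r ^+ 2 * (1 + c).
  have := chart_dist H v w; rewrite -tw -tv xw yw xv yv.
  have : (s * r) ^+ 2 = r ^+ 2 - (c * r) ^+ 2 by lra.
  lra.
have kwu : kap (mdist w u) = r ^+ 2 * (1 + c).
  have := chart_dist H w u; rewrite -tw -tu xw yw xu yu.
  have : (s * r) ^+ 2 = r ^+ 2 - (c * r) ^+ 2 by lra.
  lra.
have vwu : mdist v w = mdist w u.
  by apply: (scale_inj K); rewrite ?mdist_ge0// kvw kwu.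
have s2 : s ^+ 2 = (1 - c) * (1 + c) by lra.
have c1 : 0 < 1 + c by lra.
have long : mdist v w <= mdist u v.
  rewrite -(scale_le K) ?mdist_ge0// kvw kuv s2.
  have : 0 <= r ^+ 2 * (1 + c) * (1 - 2 * c).
    by rewrite !mulr_ge0 ?sqr_ge0//; lra.
  lra.
have k0 : 0 < kap (mdist v w) by rewrite kvw mulr_gt0.
have vw0 := scale_gt0 (mdist_ge0 v w) k0.
exists u, v, w; split=> //; split.
  move/(isosceles_collinear vwu (lt_le_trans vw0 long)) => e.
  have := scale_double K (ltW vw0); rewrite -e kuv kvw s2 leNgt => /negP; apply.
  have : 0 < r ^+ 2 * (1 + c) * (1 + c) by rewrite !mulr_gt0.
  have : 0 < r ^+ 2 * (1 + c) by rewrite !mulr_gt0.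
  lra.
rewrite (chart_circle_le K H Nu) in oz *.
split; first exact: (chart_circle_boundary H oz).
  by have e := chart_circle_le K H (etrans (esym Nu) Nv); rewrite e in oz *; exact: (chart_circle_boundary H oz).
by have e := chart_circle_le K H (etrans (esym Nu) Nw); rewrite e in oz *; exact: (chart_circle_boundary H oz).
Qed.
End InscribedTriangle.

(** The chart has pq on a line orthogonal to the axis x = 0. *)
Definition charted_plane {R : realType} (M : metricType R) (kap : R -> R) : Prop :=
  forall o p q : M, p <> q -> exists eps x y t,
    central_chart kap o eps x y t /\ y p * t q = y q * t p.

Theorem charted_plane_perim_le (R : realType) (M : metricType R) (kap : R -> R)
  (K : distance_scale kap) (charts : charted_plane M kap)
  (n : nat) (hn : (3 <= n)%N) (hodd : odd n)
  (C : set M) (hC : is_disk C)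
  (P : 'I_n -> M) (hP : simple_polygon P) (hPC : polygon_in P C) :
  exists (x y z : M) (alpha beta : R),
    [/\ inscribed_triangle x y z C,
        mdist x y = alpha, mdist y z = beta, mdist z x = beta &
        beta <= alpha /\ perim P <= (n%:R - 2) * alpha + 2 * beta].
Proof.
have ends (u v : M) : geodesic_segment u v u /\ geodesic_segment u v v.
  have [->|/eqP uv] := eqVneq u v.
    by split; exact: geodesic_segment_refl.
  have [eps [x [y [t [H _]]]]] := charts u u v uv.
  exact: (geodesic_segment_ends H uv).
have n0 : (0 < n)%N by apply: leq_trans hn.
pose len (i : 'I_n) := mdist (P i) (P (ordS i)).
have [i _ imax] : exists2 i, true & forall j, len j <= len i.
  by case: (@Order.TotalTheory.arg_maxP _ _ _ (Ordinal n0) xpredT len) => // i _ im; exists i => // j; exact: im.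
set p := P i; set q := P (ordS i).
have pq : p <> q by exact: consecutive_vertices_neq.
case: hC => o [rad [rad0 CE]].
have [eps [x [y [t [H level]]]]] := charts o p q pq.
have [z oz] : exists z, mdist o z = rad.
  have [a oa] : exists a, o <> a.
    have [op|/eqP op] := eqVneq o p; last by exists p.
    by exists q; rewrite op.
  have [ga [iso g0 _ _]] := chart_line H oa.
  by exists (ga rad); rewrite -{1}g0 iso sub0r normrN gtr0_norm.
rewrite -oz in rad0 CE.
pose r := Num.sqrt (sqnorm x y z).
have Nz0 : 0 <= sqnorm x y z by rewrite addr_ge0 ?sqr_ge0.
have Nz : sqnorm x y z = r ^+ 2 by rewrite sqr_sqrtr.
have r0 : 0 < r.
  rewrite sqrtr_gt0 lt_def Nz0 andbT; apply/eqP => Nz00.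
  have [xo yo] := chart_center H.
  have : mdist o z <= mdist o o.
    by rewrite (chart_dist_center_le K H) Nz00 addr_ge0 ?sqr_ge0.
  by rewrite mdistxx leNgt rad0.
have NP j : sqnorm x y (P j) <= sqnorm x y z.
  rewrite -(chart_dist_center_le K H).
  have : C (P j) by apply: (hPC j); have [] := ends (P j) (P (ordS j)).
  by rewrite CE.
have lenK j : kap (len j) <= kap (len i) by rewrite (scale_le K) ?mdist_ge0.
have pqE : kap (len i) = kap (mdist p q) by [].
have r20 : 0 < r ^+ 2 by rewrite exprn_gt0.
rewrite CE.
have [short|long] := leP (kap (len i)) (3 / 2 * r ^+ 2).
  have s34 : Num.sqrt (3 / 4) ^+ 2 = 3 / 4 :> R by rewrite sqr_sqrtr//; lra.
  have [||||u [v [w [ins vwu vwuv kuv kvw]]]] :=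
    @inscribed_isosceles_triangle _ _ _ _ _ _ _ _ K H z r (Num.sqrt (3 / 4)) (1 / 2) r0 Nz rad0.
  - exact: sqrtr_ge0.
  - lra.
  - by rewrite s34; lra.
  - exact: lexx.
  have uvw : mdist u v = mdist v w.
    by apply: (scale_inj K); rewrite ?mdist_ge0// kuv kvw s34; lra.
  exists u, v, w, (mdist u v), (mdist v w); split=> //.
  split=> //; apply: (perim_le hn (j := i)) => [j|].
    by rewrite -(scale_le K) ?mdist_ge0// kuv s34; apply: (le_trans (lenK j)); lra.
  rewrite mulr_natl mulr2n -uvw; apply: lerD;
    rewrite -(scale_le K) ?mdist_ge0// kuv s34.
    by apply: (le_trans (lenK i)); lra.
  by apply: (le_trans (lenK (ordS i))); lra.
(* The base of the triangle is as long as the longest edge. *)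
pose s2 := kap (len i) / (2 * r ^+ 2).
have kE : kap (len i) = 2 * r ^+ 2 * s2.
  by rewrite /s2 mulrC divfK// mulf_neq0// gt_eqF.
have s2ge : 3 / 4 <= s2 by rewrite /s2 ler_pdivlMr ?mulr_gt0//; lra.
have s2le : s2 <= 1.
  rewrite /s2 ler_pdivrMr ?mulr_gt0// mul1r.
  have := chart_scale_le_sqr H p q; rewrite -pqE.
  have := NP i; have := NP (ordS i); rewrite Nz -/p -/q /sqnorm.
  have := sqr_ge0 (x p + x q); have := sqr_ge0 (y p + y q); lra.
pose s := Num.sqrt s2; pose c := Num.sqrt (1 - s2).
have sE : s ^+ 2 = s2 by rewrite sqr_sqrtr//; lra.
have cE : c ^+ 2 = 1 - s2 by rewrite sqr_sqrtr//; lra.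
have s0 : 0 <= s by exact: sqrtr_ge0.
have c0 : 0 <= c by exact: sqrtr_ge0.
have sc : s ^+ 2 + c ^+ 2 = 1 by rewrite sE cE; ring.
have c12 : c <= 1 / 2.
  rewrite -ler_sqr ?nnegrE//; last by lra.
  by rewrite cE expr2; lra.
have [u [v [w [ins vwu vwuv kuv kvw]]]] :=
  inscribed_isosceles_triangle K H r0 Nz rad0 s0 c0 sc c12.
exists u, v, w, (mdist u v), (mdist v w); split=> //; split=> //.
have pathP j : x (P j) <= x (P (ordS j)) <= x (P (ordS (ordS j))) \/
    x (P (ordS (ordS j))) <= x (P (ordS j)) <= x (P j) ->
    len j + len (ordS j) <= 2 * mdist v w.
  move=> mono.
  suff : kap (len j) + kap (len (ordS j)) <= 2 * r ^+ 2 * (1 + c).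
    have l1 := mdist_ge0 (P j) (P (ordS j)).
    have l2 := mdist_ge0 (P (ordS j)) (P (ordS (ordS j))).
    have := scale_mid K l1 l2; rewrite -/(len j) -/(len (ordS j)) => mid hk.
    have : (len j + len (ordS j)) / 2 <= mdist v w.
      rewrite -(scale_le K) ?mdist_ge0//; last by rewrite divr_ge0// addr_ge0.
      by rewrite kvw; lra.
    lra.
  have disj k : noncrossing (P k) (P (ordS k)) p q.
    have [->|/eqP ki] := eqVneq k i; first exact: Or31.
    apply: Or33 => g gk gi; apply: (edges_meet_at_end hn hP ends _ gi gk).
    exact/nesym.
  have path := monotone_path_scale_le K H r0 Nz s0 c0 sc c12 (NP i)
    (NP (ordS i)) level _.
  have pqK : kap (mdist p q) = 2 * r ^+ 2 * s ^+ 2 by rewrite sE -kE.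
  case: mono => mono.
    exact: (path pqK _ _ _ (NP _) (NP _) (NP _) (lenK _) (lenK _) (disj _) (disj _)).
  have := path pqK _ _ _ (NP _) (NP _) (NP _) _ _ (noncrossingC (disj _))
    (noncrossingC (disj _)) mono.
  rewrite !(metric_sym (P (ordS _)) (P j)) (metric_sym (P (ordS (ordS j)))).
  by rewrite addrC => /(_ (lenK _) (lenK _)).
have [j /pathP] := odd_cycle_monotone_triple (x \o P) hodd.
apply: (perim_le hn) => k; rewrite -(scale_le K) ?mdist_ge0// kuv sE -kE.
exact: lenK.
Qed.

(** * The Euclidean plane *)

Section Euclidean.
Context {R : realType}.
Implicit Types p q u v : euclidean_plane R.

Lemma euclidean_scale : @distance_scale R (fun d => d ^+ 2 / 2).
Proof.
split=> [|a b a0 b0|a b a0 b0|a a0].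
- by rewrite expr0n mul0r.
- by rewrite ler_pM2r ?invr_gt0// ler_sqr.
- by have := sqr_ge0 (a - b); lra.
- lra.
Qed.

Lemma euclidean_sqr_mdist p q : mdist p q ^+ 2 =
  ((ecoord p).1 - (ecoord q).1) ^+ 2 + ((ecoord p).2 - (ecoord q).2) ^+ 2.
Proof. by rewrite [mdist _ _]/(euclidean_dist _ _) sqr_sqrtr// addr_ge0 ?sqr_ge0. Qed.

Lemma euclidean_charts : charted_plane (euclidean_plane R) (fun d => d ^+ 2 / 2).
Proof.
move=> o p q /eqP; rewrite -mdist_gt0 => d0.
have dE := euclidean_sqr_mdist p q.
set d := mdist p q in d0 dE; have dn : d != 0 by rewrite gt_eqF.
pose e1 := ((ecoord q).1 - (ecoord p).1) / d.
pose e2 := ((ecoord q).2 - (ecoord p).2) / d.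
have e12 : e1 ^+ 2 + e2 ^+ 2 = 1.
  rewrite !expr_div_n -mulrDl -(sqrrN (_ - (ecoord p).1)).
  by rewrite -(sqrrN (_ - (ecoord p).2)) !opprB -dE divff// expf_neq0.
pose x u := ((ecoord u).1 - (ecoord o).1) * e1 + ((ecoord u).2 - (ecoord o).2) * e2.
pose y u := ((ecoord u).2 - (ecoord o).2) * e1 - ((ecoord u).1 - (ecoord o).1) * e2.
exists 0, x, y, (fun=> 1); split; last by rewrite /y /e1 /e2; field.
split=> //.
- by left.
- by move=> u; rewrite expr1n mul0r addr0.
- by rewrite /x /y !subrr !mul0r addr0 subrr.
- move=> u v /=; rewrite subrr expr0n subr0 mulrC divfK ?pnatr_eq0//.
  rewrite euclidean_sqr_mdist.
  rewrite -[LHS]mul1r -e12 /x /y; ring.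
- move=> a b; exists (EuclideanPoint
    ((ecoord o).1 + (a * e1 - b * e2), (ecoord o).2 + (a * e2 + b * e1))).
  by rewrite /x /y /=; split; [rewrite -[RHS]mulr1 | rewrite -[RHS]mulr1]; rewrite -e12; ring.
- move=> u v /eqP; rewrite -mdist_gt0 => D0; set D := mdist u v in D0 *.
  have Dn : D != 0 by rewrite gt_eqF.
  pose ga s := EuclideanPoint
    ((ecoord u).1 + s / D * ((ecoord v).1 - (ecoord u).1),
     (ecoord u).2 + s / D * ((ecoord v).2 - (ecoord u).2)).
  exists ga; split.
  + move=> s s'; rewrite [mdist _ _]/(euclidean_dist _ _) -sqrtr_sqr; congr Num.sqrt.
    transitivity (((s - s') / D) ^+ 2 * D ^+ 2); last by field.
    by rewrite [D ^+ 2]euclidean_sqr_mdist /=; ring.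
  + by rewrite /ga !mul0r !addr0; case: (u) => -[].
  + rewrite /ga divff// !mul1r !(addrC (_ (ecoord u))) !subrK.
    by case: (v) => -[].
  + move=> l m l0 m0 lm; have lmn : l + m != 0 by rewrite gt_eqF.
    exists (m / (l + m) * D).
      apply/andP; split; first by rewrite !mulr_ge0 ?invr_ge0 ?(ltW lm) ?(ltW D0).
      by rewrite ler_piMl ?(ltW D0)// ler_pdivrMr// mul1r; lra.
    exists (l + m)^-1; first by rewrite invr_gt0.
    by rewrite /x /y /ga /= mulfK//; split; field.
Qed.

End Euclidean.


(** * The hyperbolic plane *)

Section HyperbolicFunctions.
Context {R : realType}.
Implicit Types a b : R.

Definition cosh a : R := (expR a + expR (- a)) / 2.
Definition sinh a : R := (expR a - expR (- a)) / 2.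

Lemma cosh_ge1 a : 1 <= cosh a.
Proof.
have := expRxMexpNx_1 a; have := expR_gt0 a; have := expR_gt0 (- a).
rewrite /cosh; set A := expR a; set B := expR (- a) => B0 A0 AB.
rewrite ler_pdivlMr// mul1r -ler_sqr ?nnegrE ?addr_ge0 ?(ltW A0) ?(ltW B0)//.
by have := sqr_ge0 (A - B); lra.
Qed.

Lemma cosh0 : cosh 0 = 1.
Proof. by rewrite /cosh oppr0 expR0; field. Qed.

Lemma sinh0 : sinh 0 = 0.
Proof. by rewrite /sinh oppr0 subrr mul0r. Qed.

Lemma coshN a : cosh (- a) = cosh a.
Proof. by rewrite /cosh opprK addrC. Qed.

Lemma cosh2_sinh2 a : cosh a ^+ 2 - sinh a ^+ 2 = 1.
Proof. by rewrite -(expRxMexpNx_1 a) /cosh /sinh; field. Qed.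

Lemma coshB a b : cosh (a - b) = cosh a * cosh b - sinh a * sinh b.
Proof. by rewrite /cosh /sinh opprB !expRD; field. Qed.

Lemma sinhB a b : sinh (a - b) = sinh a * cosh b - cosh a * sinh b.
Proof. by rewrite /cosh /sinh opprB !expRD; field. Qed.

Lemma sinh_ge0 a : (0 <= sinh a) = (0 <= a).
Proof.
rewrite /sinh pmulr_lge0 ?invr_gt0// subr_ge0 ler_expR; apply/idP/idP; lra.
Qed.

Lemma sinh_gt0 a : 0 < a -> 0 < sinh a.
Proof.
by move=> a0; rewrite /sinh divr_gt0// subr_gt0 ltr_expR; lra.
Qed.

Lemma ltr_cosh a b : 0 <= a -> a < b -> cosh a < cosh b.
Proof.
move=> a0 ab; rewrite -subr_gt0.
have -> : cosh b - cosh a =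
    (expR b - expR a) * (1 - expR (- a) * expR (- b)) / 2.
  have := expRxMexpNx_1 a; have := expRxMexpNx_1 b; rewrite /cosh.
  move: (expR a) (expR (- a)) (expR b) (expR (- b)) => A A' B B' BE AE.
  have -> : (B - A) * (1 - A' * B') = B - A - A' * (B * B') + B' * (A * A') by ring.
  by rewrite BE AE; ring.
rewrite divr_gt0// mulr_gt0 ?subr_gt0 ?ltr_expR//.
by rewrite -expRD expR_lt1; lra.
Qed.

Lemma ler_cosh a b : 0 <= a -> 0 <= b -> (cosh a <= cosh b) = (a <= b).
Proof.
move=> a0 b0; have [ab|ba] := leP a b; last by rewrite leNgt ltr_cosh.
move: ab; rewrite le_eqVlt => /orP[/eqP ->|ab]; first exact: lexx.
exact/ltW/ltr_cosh.
Qed.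

Lemma cosh_double a : cosh (2 * a) = 2 * cosh a ^+ 2 - 1.
Proof.
have -> : 2 * a = a - - a by ring.
rewrite coshB coshN; have -> : sinh (- a) = - sinh a by rewrite /sinh opprK; ring.
by have := cosh2_sinh2 a; lra.
Qed.

Lemma cosh_mid a b : 2 * cosh ((a + b) / 2) <= cosh a + cosh b.
Proof.
have -> : cosh a + cosh b = 2 * cosh ((a + b) / 2) * cosh ((a - b) / 2).
  have -> : cosh a = cosh ((a + b) / 2 - (b - a) / 2) by congr cosh; field.
  have -> : cosh b = cosh ((a + b) / 2 - (a - b) / 2) by congr cosh; field.
  have -> : (b - a) / 2 = - ((a - b) / 2) by field.
  rewrite !coshB coshN.
  have -> : sinh (- ((a - b) / 2)) = - sinh ((a - b) / 2) by rewrite /sinh opprK; ring.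
  ring.
by rewrite ler_peMr ?cosh_ge1// mulr_ge0// (le_trans ler01)// cosh_ge1.
Qed.

Lemma coshK a : 0 <= a -> arcosh (cosh a) = a.
Proof.
move=> a0; rewrite /arcosh.
have -> : cosh a ^+ 2 - 1 = sinh a ^+ 2 by have := cosh2_sinh2 a; lra.
rewrite sqrtr_sqr ger0_norm ?sinh_ge0//.
have -> : cosh a + sinh a = expR a by rewrite /cosh /sinh; field.
exact: expRK.
Qed.

Lemma arcosh_norm a : arcosh (cosh a) = `|a|.
Proof.
have [a0|/ltW a0] := leP 0 a; first by rewrite ger0_norm// coshK.
by rewrite ler0_norm// -coshN coshK// oppr_ge0.
Qed.

Lemma arcoshK a : 1 <= a -> cosh (arcosh a) = a.
Proof.
move=> a1; have sE : Num.sqrt (a ^+ 2 - 1) ^+ 2 = a ^+ 2 - 1.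
  by rewrite sqr_sqrtr// subr_ge0 exprn_ege1.
have s0 := sqrtr_ge0 (a ^+ 2 - 1).
rewrite /cosh /arcosh expRN lnK ?posrE; last by lra.
move: (Num.sqrt _) sE s0 => s sE s0.
have asn : a + s != 0 by rewrite gt_eqF//; lra.
have -> : (a + s)^-1 = a - s.
  apply: (mulfI asn); rewrite divff//; lra.
by field.
Qed.

Lemma arcosh_ge0 a : 1 <= a -> 0 <= arcosh a.
Proof.
move=> a1; rewrite /arcosh ln_ge0//.
by have := sqrtr_ge0 (a ^+ 2 - 1); lra.
Qed.

Lemma hyperbolic_scale : @distance_scale R (fun d => cosh d - 1).
Proof.
split=> [|a b a0 b0|a b a0 b0|a a0].
- by rewrite cosh0 subrr.
- by rewrite lerD2r ler_cosh.
- by have := cosh_mid a b; lra.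
- rewrite cosh_double; have := sqr_ge0 (cosh a - 1); lra.
Qed.

End HyperbolicFunctions.

Section Lorentz.
Context {R : realType}.
Implicit Types (u v w e : R * R * R) (a b c d : R).

Definition comb a u b v : R * R * R :=
  (a * u.1.1 + b * v.1.1, a * u.1.2 + b * v.1.2, a * u.2 + b * v.2).

Lemma lorentz_combl a u b v w :
  lorentz (comb a u b v) w = a * lorentz u w + b * lorentz v w.
Proof. by rewrite /lorentz /=; ring. Qed.

Lemma lorentz_combr a u b v w :
  lorentz w (comb a u b v) = a * lorentz w u + b * lorentz w v.
Proof. by rewrite /lorentz /=; ring. Qed.

(** The cross product for the Lorentz form: lorentz w (lorentz_cross u v) is,
    up to sign, the determinant of u, v, w. *)
Definition lorentz_cross u v : R * R * R :=
  (u.1.2 * v.2 - u.2 * v.1.2, u.2 * v.1.1 - u.1.1 * v.2,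
   u.1.2 * v.1.1 - u.1.1 * v.1.2).

Lemma lorentz_crossl u v : lorentz u (lorentz_cross u v) = 0.
Proof. by rewrite /lorentz /=; ring. Qed.

Lemma lorentz_crossr u v : lorentz v (lorentz_cross u v) = 0.
Proof. by rewrite /lorentz /=; ring. Qed.

(** The product of two determinants is the Gram determinant, as the Lorentz
    form has determinant 1. *)
Lemma lorentz_cross_gram o e u v :
  lorentz u (lorentz_cross o e) * lorentz v (lorentz_cross o e) =
  lorentz o o * (lorentz e e * lorentz u v - lorentz e v * lorentz u e)
  - lorentz o e * (lorentz e o * lorentz u v - lorentz e v * lorentz u o)
  + lorentz o v * (lorentz e o * lorentz u e - lorentz e e * lorentz u o).
Proof. by rewrite /lorentz /=; ring. Qed.

(** The vectors o, e and their cross product form an orthonormal frame. *)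
Lemma lorentz_expand o e u v :
  lorentz o o = 1 -> lorentz o e = 0 -> lorentz e e = -1 ->
  lorentz u v = lorentz u o * lorentz v o - lorentz u e * lorentz v e
    - lorentz u (lorentz_cross o e) * lorentz v (lorentz_cross o e).
Proof.
move=> oo oe ee; rewrite lorentz_cross_gram oo oe ee (lorentzC e o) oe.
by rewrite (lorentzC o v) (lorentzC e v); ring.
Qed.

Lemma lorentz_cross_sqr o e :
  lorentz o o = 1 -> lorentz o e = 0 -> lorentz e e = -1 ->
  lorentz (lorentz_cross o e) (lorentz_cross o e) = -1.
Proof.
move=> oo oe ee.
have -> : lorentz (lorentz_cross o e) (lorentz_cross o e) =
  lorentz o o * lorentz e e - lorentz o e ^+ 2 by rewrite /lorentz /=; ring.
by rewrite oo oe ee; ring.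
Qed.

Lemma lorentz_upper_sheet u v : 0 < u.2 -> lorentz u u = 1 ->
  lorentz v v = 1 -> 0 < lorentz v u -> 0 < v.2.
Proof.
case: u v => [[x y] z] [[x' y'] z'] /=; rewrite /lorentz /= => z0 hu hv huv.
rewrite ltNge; apply/negP => z'0.
have h1 : 0 < z * z' - (x * x' + y * y') by lra.
have h2 : 0 <= z * - z' by rewrite mulr_ge0 ?oppr_ge0// ltW.
have h3 : (z * - z') ^+ 2 < (x * x' + y * y') ^+ 2.
  by rewrite -(sqrrN (x * x' + _)) ltr_sqr ?nnegrE//; lra.
have zE : z ^+ 2 = 1 + x ^+ 2 + y ^+ 2 by lra.
have zE' : z' ^+ 2 = 1 + x' ^+ 2 + y' ^+ 2 by lra.
move: h3; rewrite exprMn sqrrN zE zE'.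
have := sqr_ge0 (x * y' - y * x'); have := sqr_ge0 x; have := sqr_ge0 y.
have := sqr_ge0 x'; have := sqr_ge0 y'; lra.
Qed.

(** The Lorentz complement of a timelike vector is negative definite. *)
Lemma lorentz_orthogonal_lt0 u v : 0 < u.2 -> lorentz u u = 1 ->
  lorentz v u = 0 -> lorentz v v < 0 \/ v = (0, 0, 0).
Proof.
case: u v => [[x y] z] [[x' y'] z'] /=; rewrite /lorentz /= => z0 hu huv.
have zE : z ^+ 2 = 1 + x ^+ 2 + y ^+ 2 by lra.
have key : z ^+ 2 * (z' * z' - x' * x' - y' * y') =
    - (x' ^+ 2 + y' ^+ 2 + (x * y' - y * x') ^+ 2).
  have -> : z ^+ 2 * (z' * z' - x' * x' - y' * y') =
    (z' * z) ^+ 2 - z ^+ 2 * (x' ^+ 2 + y' ^+ 2) by ring.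
  have -> : z' * z = x' * x + y' * y by lra.
  by rewrite zE; ring.
have z20 : 0 < z ^+ 2 by rewrite exprn_gt0.
have sx := sqr_ge0 x'; have sy := sqr_ge0 y'; have st := sqr_ge0 (x * y' - y * x').
have [xy0|xy0] := eqVneq (x' ^+ 2 + y' ^+ 2) 0.
  have /eqP x0 : x' ^+ 2 == 0 by apply/eqP; lra.
  have /eqP y0 : y' ^+ 2 == 0 by apply/eqP; lra.
  move/eqP: x0; move/eqP: y0; rewrite !sqrf_eq0 => /eqP y0 /eqP x0.
  right; rewrite x0 y0; congr (_, _).
  have /eqP : z' * z = 0 by rewrite x0 y0 in huv; lra.
  by rewrite mulf_eq0 (gt_eqF z0) orbF => /eqP.
left; rewrite -(pmulr_rlt0 _ z20) key oppr_lt0.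
have : 0 < x' ^+ 2 + y' ^+ 2 by rewrite lt_def xy0 addr_ge0.
lra.
Qed.

End Lorentz.

Section HyperbolicPlane.
Context {R : realType}.
Implicit Types o p q u v : hyperbolic_plane R.

Lemma hcoord_gt0 u : 0 < (hcoord u).2.
Proof. by case: u => c /= /andP[]. Qed.

Lemma lorentz_hcoord u : lorentz (hcoord u) (hcoord u) = 1.
Proof. by case: u => c /= /andP[_ /eqP]. Qed.

Lemma hyperbolic_mdistE u v :
  mdist u v = arcosh (lorentz (hcoord u) (hcoord v)).
Proof. by []. Qed.

Lemma cosh_mdist u v : cosh (mdist u v) = lorentz (hcoord u) (hcoord v).
Proof. by rewrite hyperbolic_mdistE arcoshK// lorentz_ge1. Qed.

Lemma hyperbolic_point u (a : R * R * R) :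
  lorentz a a = 1 -> 0 < lorentz a (hcoord u) ->
  hcoord (insubd u a : hyperbolic_plane R) = a.
Proof.
move=> aa au; apply: insubdK; apply/andP; split; last exact/eqP.
exact: (lorentz_upper_sheet (hcoord_gt0 u) (lorentz_hcoord u)).
Qed.

(** The point at parameter s is cosh s u + sinh s w, with w the unit tangent
    vector at u towards v. *)
Lemma hyperbolic_line u v : u <> v -> exists ga : R -> hyperbolic_plane R,
  [/\ forall s s', mdist (ga s) (ga s') = `|s - s'|,
      ga 0 = u, ga (mdist u v) = v &
      forall l m, 0 <= l -> 0 <= m -> 0 < l + m ->
        exists2 s, 0 <= s <= mdist u v & exists2 k, 0 < k &
          hcoord (ga s) = comb (k * l) (hcoord u) (k * m) (hcoord v)].
Proof.
move=> /eqP; rewrite -mdist_gt0; set d := mdist u v => d0.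
set U := hcoord u; set V := hcoord v.
have UU : lorentz U U = 1 by exact: lorentz_hcoord.
have VV : lorentz V V = 1 by exact: lorentz_hcoord.
set C := lorentz U V.
have CE : cosh d = C by exact: cosh_mdist.
have VU : lorentz V U = C by rewrite lorentzC.
have S0 := sinh_gt0 d0.
set S := sinh d in S0.
have Sn : S != 0 by rewrite gt_eqF.
have CS : C ^+ 2 = 1 + S ^+ 2 by rewrite -CE; have := cosh2_sinh2 d; rewrite -/S; lra.
pose A s := cosh s - sinh s * C / S.
pose B s := sinh s / S.
pose W s := comb (A s) U (B s) V.
have WW s s' : lorentz (W s) (W s') = cosh (s - s').
  rewrite lorentz_combl !lorentz_combr UU VV VU -/C coshB.
  have -> : A s * (A s' * 1 + B s' * C) + B s * (A s' * C + B s' * 1) =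
     cosh s * cosh s' + sinh s * sinh s' * (1 - C ^+ 2) / S ^+ 2.
    by rewrite /A /B; field.
  by rewrite CS; field.
have WU s : lorentz (W s) U = cosh s.
  by rewrite lorentz_combl UU VU /A /B; field.
pose ga s : hyperbolic_plane R := insubd u (W s).
have gaE s : hcoord (ga s) = W s.
  apply: hyperbolic_point; first by rewrite WW subrr cosh0.
  by rewrite WU (lt_le_trans ltr01)// cosh_ge1.
have hinj (a b : hyperbolic_plane R) : hcoord a = hcoord b -> a = b.
  by move=> ab; apply: val_inj.
exists ga; split.
- by move=> s s'; rewrite hyperbolic_mdistE !gaE WW arcosh_norm.
- apply: hinj; rewrite gaE /W /A /B.
  rewrite cosh0 sinh0 !mul0r subr0 /comb !mul1r !mul0r !addr0.
  by rewrite /U; case: (hcoord u) => -[].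
- apply: hinj; rewrite gaE /W /A /B CE -/S divff// mulrAC divff// mul1r subrr.
  rewrite /comb !mul0r !add0r !mul1r.
  by rewrite /V; case: (hcoord v) => -[].
- move=> l m l0 m0 lm.
  have C1 : 1 <= C by rewrite -CE cosh_ge1.
  have n0 : 0 < l ^+ 2 + m ^+ 2 + 2 * l * m * C.
    have : 0 <= 2 * l * m * (C - 1) by rewrite !mulr_ge0// subr_ge0.
    have : 0 < (l + m) ^+ 2 by rewrite exprn_gt0.
    lra.
  set k := (Num.sqrt (l ^+ 2 + m ^+ 2 + 2 * l * m * C))^-1.
  have k0 : 0 < k by rewrite invr_gt0 sqrtr_gt0.
  have kE : k ^+ 2 * (l ^+ 2 + m ^+ 2 + 2 * l * m * C) = 1.
    by rewrite exprVn sqr_sqrtr ?(ltW n0)// mulVf// gt_eqF.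
  set a := k * l; set b := k * m.
  have a0 : 0 <= a by rewrite mulr_ge0// ltW.
  have b0 : 0 <= b by rewrite mulr_ge0// ltW.
  have ab1 : a ^+ 2 + b ^+ 2 + 2 * a * b * C = 1.
    by apply: etrans kE; rewrite /a /b; ring.
  have c2 : (a + b * C) ^+ 2 = 1 + (b * S) ^+ 2.
    rewrite exprMn; have -> : S ^+ 2 = C ^+ 2 - 1 by lra.
    lra.
  have c1 : 1 <= a + b * C.
    have bC0 := mulr_ge0 b0 (le_trans ler01 C1).
    rewrite -ler_sqr ?nnegrE ?(addr_ge0 a0 bC0)//.
    by rewrite expr1n c2 lerDl sqr_ge0.
  set s := arcosh (a + b * C).
  have s0 : 0 <= s by exact: (arcosh_ge0 c1).
  have ch : cosh s = a + b * C by exact: (arcoshK c1).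
  have sh : sinh s = b * S.
    apply/eqP; rewrite -(@eqrXn2 _ 2) ?sinh_ge0 ?(mulr_ge0 b0 (ltW S0))//.
    by have := cosh2_sinh2 s; rewrite ch c2 => h; apply/eqP; lra.
  exists s.
    rewrite s0 -subr_ge0 -sinh_ge0 sinhB CE ch sh -/S.
    have -> : S * (a + b * C) - C * (b * S) = S * a by ring.
    exact: mulr_ge0 (ltW S0) a0.
  exists k => //; rewrite gaE /W; congr comb.
    by rewrite /A ch sh /a; field.
  by rewrite /B sh /b; field.
Qed.

Lemma hyperbolic_chart o (e : R * R * R) :
  lorentz (hcoord o) e = 0 -> lorentz e e = -1 ->
  central_chart (fun d => cosh d - 1) o 1
    (fun u => - lorentz (hcoord u) e)
    (fun u => - lorentz (hcoord u) (lorentz_cross (hcoord o) e))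
    (fun u => lorentz (hcoord u) (hcoord o)).
Proof.
move=> oe ee; have oo := lorentz_hcoord o.
set f := lorentz_cross (hcoord o) e.
have ex a b : lorentz a b = _ := lorentz_expand a b oo oe ee.
have sheet u : lorentz (hcoord u) (hcoord o) ^+ 2 =
    1 + 1 * ((- lorentz (hcoord u) e) ^+ 2 + (- lorentz (hcoord u) f) ^+ 2).
  by have := lorentz_hcoord u; rewrite ex -/f; lra.
split.
- by right.
- by move=> u; rewrite (lt_le_trans ltr01)// lorentz_ge1.
- exact: sheet.
- by rewrite oe lorentz_crossl oppr0.
- move=> u v /=; rewrite cosh_mdist ex -/f.
  have := sheet u; have := sheet v; lra.
- move=> a b; pose T := Num.sqrt (1 + a ^+ 2 + b ^+ 2).
  have T20 : 0 < 1 + a ^+ 2 + b ^+ 2.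
    by have := sqr_ge0 a; have := sqr_ge0 b; lra.
  have T0 : 0 < T by rewrite sqrtr_gt0.
  have T2 : T ^+ 2 = 1 + a ^+ 2 + b ^+ 2 by rewrite sqr_sqrtr// ltW.
  pose X := comb 1 (comb T (hcoord o) a e) b f.
  have eo : lorentz e (hcoord o) = 0 by rewrite lorentzC.
  have of0 : lorentz (hcoord o) f = 0 by exact: lorentz_crossl.
  have ef0 : lorentz e f = 0 by exact: lorentz_crossr.
  have fo : lorentz f (hcoord o) = 0 by rewrite lorentzC.
  have fe : lorentz f e = 0 by rewrite lorentzC.
  have ff : lorentz f f = -1 by exact: lorentz_cross_sqr.
  have Xo : lorentz X (hcoord o) = T.
    by rewrite !lorentz_combl oo eo fo; ring.
  have Xe : lorentz X e = - a by rewrite !lorentz_combl oe ee fe; ring.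
  have Xf : lorentz X f = - b by rewrite !lorentz_combl of0 ef0 ff; ring.
  have XX : lorentz X X = 1 by rewrite ex -/f Xo Xe Xf; lra.
  exists (insubd o X); rewrite (hyperbolic_point XX) ?Xo//.
  by rewrite Xe Xf !opprK.
- move=> u v uv; have [ga [iso g0 g1 seg]] := hyperbolic_line uv.
  exists ga; split=> // l m l0 m0 lm; have [s hs [k k0 gE]] := seg l m l0 m0 lm.
  exists s => //; exists k => //; rewrite gE !lorentz_combl.
  by split; ring.
Qed.

Lemma hyperbolic_charts :
  charted_plane (hyperbolic_plane R) (fun d => cosh d - 1).
Proof.
move=> o p q pq.
set O := hcoord o; set tp := lorentz (hcoord p) O; set tq := lorentz (hcoord q) O.
have oo : lorentz O O = 1 := lorentz_hcoord o.
pose w := comb tp (hcoord q) (- tq) (hcoord p).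
have wo : lorentz w O = 0 by rewrite lorentz_combl -/tp -/tq; ring.
have tp0 : 0 < tp by rewrite (lt_le_trans ltr01)// lorentz_ge1.
have tq0 : 0 < tq by rewrite (lt_le_trans ltr01)// lorentz_ge1.
have ww : lorentz w w < 0.
  have [//|w0] := lorentz_orthogonal_lt0 (hcoord_gt0 o) oo wo.
  exfalso; apply: pq; apply: val_inj => /=.
  have [w1 w2 w3] : [/\ tp * (hcoord q).1.1 = tq * (hcoord p).1.1,
      tp * (hcoord q).1.2 = tq * (hcoord p).1.2 &
      tp * (hcoord q).2 = tq * (hcoord p).2].
    by move: w0 => [] /= e1 e2 e3; split; lra.
  have tpq : tp = tq.
    apply/eqP; rewrite -(@eqrXn2 _ 2)// ?ltW//; apply/eqP.
    rewrite -[LHS]mulr1 -[RHS]mulr1 -{1}(lorentz_hcoord q) -(lorentz_hcoord p).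
    transitivity ((tp * (hcoord q).2) ^+ 2 - (tp * (hcoord q).1.1) ^+ 2
      - (tp * (hcoord q).1.2) ^+ 2); first by rewrite /lorentz; ring.
    by rewrite w1 w2 w3 /lorentz; ring.
  have tn : tq != 0 by rewrite gt_eqF.
  move: w1 w2 w3; rewrite tpq => /(mulfI tn) w1 /(mulfI tn) w2 /(mulfI tn) w3.
  by case: (hcoord p) (hcoord q) w1 w2 w3 => [[? ?] ?] [[? ?] ?] /= -> -> ->.
set k := (Num.sqrt (- lorentz w w))^-1.
have k2 : k ^+ 2 * lorentz w w = -1.
  rewrite exprVn sqr_sqrtr ?oppr_ge0 ?(ltW ww)// invrN mulNr mulVf//.
  by rewrite lt_eqF.
pose e := comb k w 0 w.
have eE (a : R * R * R) : lorentz a e = k * lorentz a w.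
  by rewrite lorentz_combr mul0r addr0.
have oe : lorentz O e = 0 by rewrite eE (lorentzC O) wo mulr0.
have ee : lorentz e e = -1 by rewrite eE lorentzC eE mulrA -expr2.
exists 1, (fun u => - lorentz (hcoord u) e),
  (fun u => - lorentz (hcoord u) (lorentz_cross O e)),
  (fun u => lorentz (hcoord u) O); split; first exact: hyperbolic_chart.
have := lorentz_crossr O e; set f := lorentz_cross O e.
rewrite lorentzC eE => /eqP; rewrite mulf_eq0 => /orP[/eqP k0|].
  by move: k2; rewrite k0 expr0n mul0r; lra.
rewrite lorentz_combr !(lorentzC f) -/tp -/tq => /eqP; lra.
Qed.

End HyperbolicPlane.

(** * The perimeter bound in both planes *)

Theorem mainTheorem1 (R : realType) (M : metricType R)
  (hM : M = euclidean_plane R \/ M = hyperbolic_plane R)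
  (n : nat) (hn : (3 <= n)%N) (hodd : odd n)
  (C : set M) (hC : is_disk C)
  (P : 'I_n -> M) (hP : simple_polygon P) (hPC : polygon_in P C) :
  exists (x y z : M) (alpha beta : R),
    [/\ inscribed_triangle x y z C,
        mdist x y = alpha, mdist y z = beta, mdist z x = beta &
        beta <= alpha /\ perim P <= (n%:R - 2) * alpha + 2 * beta].
Proof.
case: hM => e; subst M.
  exact: (charted_plane_perim_le euclidean_scale (@euclidean_charts R) hn hodd
    hC hP hPC).
exact: (charted_plane_perim_le hyperbolic_scale (@hyperbolic_charts R) hn hodd
  hC hP hPC).
Qed.
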